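(* Let $0<p\le q\le+\infty$ and let $a<b$ be fixed real numbers. Then $\Big(\bigcap_{0<s<p}H^s\setminus H^q_{[a,b]}(D)\Big)\cup\{0\}$ contains a vector space dense in $\bigcap_{0<s<p}H^s$ endowed with its natural topology. Moreover, if $p<q$, the space $\bigcap_{0<s<p}H^s$ can be replaced by $H^p$; that is, if $0<p<q\le+\infty$, then $\big(H^p\setminus H^q_{[a,b]}(D)\big)\cup\{0\}$ contains a vector space dense in $H^p$.
   Context: $D=\{z\in\mathbb{C}:|z|<1\}$. For $0<s<\infty$, $H^s=H^s(D)$ is the Hardy space of holomorphic functions $f$ on $D$ with $\sup_{0<r<1}\int_0^{2\pi}|f(re^{i\theta})|^s\,d\theta<+\infty$, with its usual complete metrizable vector space topology: $f_n\to f$ in $H^s$ iff $\sup_{0<r<1}\int_0^{2\pi}|f_n(re^{i\theta})-f(re^{i\theta})|^s\,d\theta\to0$. The natural topology of $\bigcap_{0<s<p}H^s$ is the metrizable topology in which $f_n\to f$ iff $f_n\to f$ in $H^s$ for every $s\in(0,p)$. For real $a<b$ and $0<q<\infty$, the localized Hardy space $H^q_{[a,b]}(D)$ is the set of holomorphic functions $f$ on $D$ with $\sup_{0<r<1}\int_a^b|f(re^{i\theta})|^q\,d\theta<+\infty$. For $q=+\infty$, $H^\infty_{[a,b]}(D)$ is the set of holomorphic functions $f$ on $D$ with $\sup_{0<r<1}\sup_{a\le\theta\le b}|f(re^{i\theta})|<+\infty$. Vector spaces are over $\mathbb{C}$. *)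

(* Defs.v *)
From HB Require Import structures.
From mathcomp Require Import all_boot all_order all_algebra.
From mathcomp Require Import all_classical all_reals all_analysis.
From mathcomp Require Import complex.

Set Implicit Arguments.
Unset Strict Implicit.
Unset Printing Implicit Defensive.

Import Order.TTheory GRing.Theory Num.Theory.
Import numFieldNormedType.Exports.

Local Open Scope classical_set_scope.
Local Open Scope ring_scope.

Section LocalizedHardy.
Context {R : realType}.
Local Open Scope complex_scope.

(* The codomain is the regular module R[i]^o, so that the pointwise vector
   space structure of functions has scalars in R[i] (the default module
   structure of R[i] is the one over R). *)
Local Notation cfun := (R[i] -> R[i]^o).

Definition unit_disc : set R[i] := [set z | `|z| < 1].

(* A function on the disc is represented by its extension by 0, so that
   equality in [cfun] is equality on the disc. *)
Definition holomorphic_disc : set cfun :=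
  [set f | (forall z : R[i]^o, unit_disc z -> derivable (f : R[i]^o -> R[i]^o) z 1)
           /\ (forall z, ~ unit_disc z -> f z = 0)].

Definition cpolar (r t : R) : R[i] := (r * cos t) +i* (r * sin t).

Definition modulus (z : R[i]) : R := complex.Re `|z|.

Definition radial_mean (s a b : R) (f : cfun) : \bar R :=
  ereal_sup [set (\int[lebesgue_measure]_(t in `[a, b])
                    (modulus (f (cpolar r t)) `^ s)%:E)%E | r in `]0, 1[].

Definition radial_sup (a b : R) (f : cfun) : \bar R :=
  ereal_sup [set ereal_sup [set (modulus (f (cpolar r t)))%:E | t in `[a, b]]
            | r in `]0, 1[].

Definition hardy (s : R) : set cfun :=
  [set f | holomorphic_disc f /\ (radial_mean s 0 (2 * pi) f < +oo)%E].

(* Only 0 < q matters; the -oo branch is never used. *)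
Definition local_hardy (q : \bar R) (a b : R) : set cfun :=
  [set f | holomorphic_disc f /\
    match q with
    | q%:E => (radial_mean q a b f < +oo)%E
    | +oo%E => (radial_sup a b f < +oo)%E
    | -oo%E => False
    end].

Definition exponents_below (p : \bar R) : set R :=
  [set s | 0 < s /\ (s%:E < p)%E].

(* The intersection of the spaces H^s for s in S, as a topological space:
   it carries the coarsest topology making all the inclusions into the H^s
   continuous. For S = [set p] this is H^p with its usual topology, given by
   the balls [set g | radial_mean p 0 (2 * pi) (g - f) < e]. *)
Definition hardy_space (S : set R) : Type :=
  {f : cfun | (\bigcap_(s in S) hardy s) f}.

HB.instance Definition _ (S : set R) := gen_eqMixin (hardy_space S).
HB.instance Definition _ (S : set R) := gen_choiceMixin (hardy_space S).

Section Topology.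
Variable S : set R.
Implicit Types (U : set (hardy_space S)) (f g : hardy_space S).

Definition hardy_ball f (ss : seq R) (e : R) : set (hardy_space S) :=
  [set g | forall s, s \in ss ->
     (radial_mean s 0 (2 * pi) (sval g - sval f)%R < e%:E)%E].

Definition hardy_open : set_system (hardy_space S) :=
  [set U | forall f, U f -> exists ss : seq R, exists e : R,
     [/\ forall s, s \in ss -> S s, 0 < e & hardy_ball f ss e `<=` U]].

Let hardy_openT : hardy_open setT.
Proof. by move=> f _; exists [::], 1; split. Qed.

Let hardy_openI : setI_closed hardy_open.
Proof.
move=> U V oU oV f [/oU[s1 [e1 [S1 e10 sub1]]] /oV[s2 [e2 [S2 e20 sub2]]]].
exists (s1 ++ s2), (Num.min e1 e2); split.
- by move=> s; rewrite mem_cat => /orP[/S1|/S2].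
- by rewrite lt_min e10 e20.
- move=> g fg; split.
  + apply: sub1 => s ss1; apply: lt_le_trans (fg s _) _.
      by rewrite mem_cat ss1.
    by rewrite lee_fin ge_min lexx.
  + apply: sub2 => s ss2; apply: lt_le_trans (fg s _) _.
      by rewrite mem_cat ss2 orbT.
    by rewrite lee_fin ge_min lexx orbT.
Qed.

Let hardy_open_bigU (I : Type) (U : I -> set (hardy_space S)) :
  (forall i, hardy_open (U i)) -> hardy_open (\bigcup_i U i).
Proof.
move=> oU f [i _ /oU[ss [e [Sss e0 sub]]]]; exists ss, e; split => //.
by move=> g /sub Uig; exists i.
Qed.

HB.instance Definition _ := isOpenTopological.Build (hardy_space S)
  hardy_openT hardy_openI hardy_open_bigU.

End Topology.

(* Meant for A included in the intersection of the H^s for s in S, so that V is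
   a subset of that space. *)
Definition contains_dense_subspace (S : set R) (A : set cfun) : Prop :=
  exists V : set cfun,
    [/\ submod_closed [pred f : cfun | f \in V], V `<=` A
      & dense [set f : hardy_space S | V (sval f)]].

End LocalizedHardy.

(* Main.v *)
Require Import Defs.
From HB Require Import structures.
From mathcomp Require Import all_boot all_order all_algebra.
From mathcomp Require Import all_classical all_reals all_analysis.
From mathcomp Require Import complex.
From mathcomp Require Import measurable_realfun.
From mathcomp Require Import ring lra.

(* Write X for the space of functions under consideration and Y for the local
   Hardy space on [a, b]; density of the polynomials in X is not needed. Let h be
   in X, bounded away from 1, and not in H^q near 1: h = (1 - z)^(-1/p) (with a
   larger exponent instead of p if p < q and X = H^p), or h = log (1 - z) when
   p = q = oo. Its rotations h_t, singular at exp(i t), are independent modulo Y,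
   and there are continuum many with a < t < b. A holomorphic function is
   determined by its values at rational points, so the pairs (y, n) with y in
   X /\ Y can be coded injectively by angles t(y, n). The span V0 of the
   y + h_t(y, n) / (n + 1) meets Y only at 0; by Zorn's lemma it is contained in
   a subspace V of X which meets Y only at 0 and satisfies X <= V + Y. Then V is
   dense: if f = v + y with v in V and y in X /\ Y, the elements
   v + y + h_t(y, n) / (n + 1) of V tend to f as n tends to infinity. *)

Set Implicit Arguments.
Unset Strict Implicit.
Unset Printing Implicit Defensive.

Import Order.TTheory GRing.Theory Num.Theory.
Import numFieldNormedType.Exports.

Local Open Scope classical_set_scope.
Local Open Scope ring_scope.

(** * Complements of subspaces *)

(** Each pair (y, n) needs an angle of its own: two generators sharing an angle would have a
    combination in Y, in general nonzero. This is why as many directions independent modulo Y are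
    needed as there are pairs. Since the coding lets t(y, n) depend on n without control,
    convergence to f requires the means of h_t to be bounded uniformly in t. Independence modulo Y
    is tested by one-sided germs: the functions in H^q on [t, t + d] for some d > 0 form a subspace
    that contains Y and every h_u with u another of the angles, but not h_t. All estimates are made
    in the variable w = 1 - z exp(- i t). It has positive real part, so a logarithm whose argument
    is an arctangent is enough. Powers of h are bounded above by |w|^(-beta) with beta < 1, whose
    integrals are bounded in r, and for finite q bounded below by |w|^(-1), whose integral diverges
    logarithmically as r tends to 1. *)

Definition subspace (K : fieldType) (U : lmodType K) (V : set U) : Prop :=
  V 0 /\ forall (a : K) u v, V u -> V v -> V (a *: u + v).

Section Subspaces.
Context {K : fieldType} {U : lmodType K}.
Implicit Types V W X Y : set U.

Lemma subspace_submod V : subspace V -> submod_closed [pred f : U | f \in V].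
Proof.
move=> [V0 Vl]; split=> [|a u v]; rewrite !unfold_in /= ?inE //.
exact: Vl.
Qed.

Lemma subspaceZ V a u : subspace V -> V u -> V (a *: u).
Proof. by move=> [V0 Vl] Vu; rewrite -[_ *: _]addr0; exact: Vl. Qed.

Lemma subspaceD V u v : subspace V -> V u -> V v -> V (u + v).
Proof. by move=> [V0 Vl] Vu Vv; rewrite -[u]scale1r; exact: Vl. Qed.

Lemma subspaceB V u v : subspace V -> V u -> V v -> V (u - v).
Proof.
by move=> sV Vu Vv; apply: subspaceD => //; rewrite -scaleN1r; exact: subspaceZ.
Qed.

Lemma subspace_sum V (I : eqType) (s : seq I) (F : I -> U) : subspace V ->
  (forall i, i \in s -> V (F i)) -> V (\sum_(i <- s) F i).
Proof.
move=> sV VF; rewrite big_seq; apply: (big_ind V) => //; first by case: sV.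
by move=> u v; exact: subspaceD.
Qed.

(** Maximality yields the last clause: if [x] lies outside V + Y, adding the line through [x] to V
    creates no new intersection with [Y], because a relation v + a x in [Y] with a != 0 would put
    [x] into V + Y. *)
Lemma exists_complement_above (X Y V0 : set U) :
  subspace X -> subspace Y -> subspace V0 -> V0 `<=` X ->
  (forall u, V0 u -> Y u -> u = 0) ->
  exists V, [/\ subspace V, V0 `<=` V, V `<=` X, forall u, V u -> Y u -> u = 0
    & forall x, X x -> exists2 v, V v & Y (x - v)].
Proof.
move=> sX sY sV0 V0X V0Y.
pose P (W : set U) := W = set0 \/
  [/\ subspace W, V0 `<=` W, W `<=` X & forall u, W u -> Y u -> u = 0].
have [F FP Ftot|V [[Ve|[sV V0V VX VY]] Vmax]] := @Zorn_bigcup U P.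
- have [Fne|Fe] := pselect (exists2 W, F W & W !=set0); last first.
    left; rewrite -subset0 => u [W FW Wu]; apply: Fe.
    by exists W => //; exists u.
  have Fgood W : F W -> W !=set0 ->
      [/\ subspace W, V0 `<=` W, W `<=` X & forall u, W u -> Y u -> u = 0].
    by move=> FW [u Wu]; have [We|//] := FP _ FW; rewrite We in Wu.
  right; split.
  + split; first by case: Fne => W FW W0; exists W => //; case: (Fgood _ FW W0) => -[].
    move=> a u v [W1 FW1 W1u] [W2 FW2 W2v].
    have [s1 _ _ _] := Fgood _ FW1 (ex_intro _ u W1u).
    have [s2 _ _ _] := Fgood _ FW2 (ex_intro _ v W2v).
    have [W12|W21] := Ftot _ _ FW1 FW2.
      by exists W2 => //; apply: s2.2 => //; exact: W12.
    by exists W1 => //; apply: s1.2 => //; exact: W21.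
  + case: Fne => W FW W0 u V0u; exists W => //.
    by have [_ + _ _] := Fgood _ FW W0; exact.
  + by move=> u [W FW Wu]; have [_ _ + _] := Fgood _ FW (ex_intro _ u Wu); exact.
  + move=> u [W FW Wu]; have [_ _ _] := Fgood _ FW (ex_intro _ u Wu); exact.
- exfalso; apply: (Vmax V0); last by right; split.
  rewrite Ve; split; first exact: sub0set.
  by move=> /(_ 0 sV0.1).
- exists V; split=> // x Xx; apply: contrapT => nx.
  pose W := [set w | exists2 v, V v & exists a, w = v + a *: x].
  have VW : V `<=` W by move=> v Vv; exists v => //; exists 0; rewrite scale0r addr0.
  apply: (Vmax W); first split=> //.
    move=> WV; apply: nx; exists x; last by rewrite subrr; exact: sY.1.
    apply: WV; exists 0; first exact: sV.1.
    by exists 1; rewrite scale1r add0r.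
  right; split.
  + split; first by apply: VW; exact: sV.1.
    move=> c u v [u1 Vu1 [a ->]] [v1 Vv1 [b ->]].
    exists (c *: u1 + v1); first exact: sV.2.
    by exists (c * a + b); rewrite scalerDr scalerA scalerDl addrACA.
  + exact: subset_trans V0V VW.
  + move=> u [v Vv [a ->]]; apply: subspaceD => //; first exact: VX.
    exact: subspaceZ.
  + move=> u [v Vv [a ->]]; have [->|a0] := eqVneq a 0.
      by rewrite scale0r addr0; exact: VY.
    move=> Yu; exfalso; apply: nx; exists (- a^-1 *: v); first exact: subspaceZ.
    have -> : x - - a^-1 *: v = a^-1 *: (v + a *: x).
      by rewrite scalerDr scalerA mulVf// scale1r scaleNr opprK addrC.
    exact: subspaceZ.
Qed.

(* The sets [Z i] play the role of the kernels of a dual family: they force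
   every linear relation modulo [Y] between the [v i] to be trivial. *)
Lemma exists_complement_through (X Y : set U) (I : choiceType) (v : I -> U)
    (Z : I -> set U) :
  subspace X -> subspace Y -> (forall i, X (v i)) ->
  (forall i, subspace (Z i)) -> (forall i, Y `<=` Z i) ->
  (forall i j, i != j -> Z i (v j)) -> (forall i, ~ Z i (v i)) ->
  exists V, [/\ subspace V, forall i, V (v i), V `<=` X,
    forall u, V u -> Y u -> u = 0
    & forall x, X x -> exists2 v, V v & Y (x - v)].
Proof.
move=> sX sY Xv sZ YZ Zv nZv.
pose V0 := [set u | exists (s : seq I) (a : I -> K),
  uniq s /\ u = \sum_(i <- s) a i *: v i].
have [| | |V [sV V0V VX VY VXY]] := @exists_complement_above X Y V0 sX sY.
- split; first by exists [::], (fun=> 0); rewrite big_nil.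
  move=> c _ _ [s [a [us ->]]] [t [b [ut ->]]].
  (* Two combinations are added over a common index list, their coefficients being extended by 0. *)
  pose r := undup (s ++ t); have ur : uniq r := undup_uniq _.
  exists r, (fun i => c * (if i \in s then a i else 0) +
                      (if i \in t then b i else 0)); split=> //.
  have restr (s' : seq I) (a' : I -> K) : uniq s' -> {subset s' <= r} ->
      \sum_(i <- s') a' i *: v i =
      \sum_(i <- r) (if i \in s' then a' i else 0) *: v i.
    move=> us' s'r; rewrite [RHS](bigID (mem s'))/= [X in _ + X]big1 ?addr0; last first.
      by move=> i /negbTE ->; rewrite scale0r.
    under [RHS]eq_bigr => i -> do idtac.
    rewrite -[RHS]big_filter.
    apply: perm_big; apply: uniq_perm => //; first by rewrite filter_uniq.
    move=> i; rewrite mem_filter /=; case: (boolP (i \in s')) => //= /s'r ->.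
    by [].
  rewrite (restr s) // => [|i si]; last by rewrite mem_undup mem_cat si.
  rewrite (restr t) // => [|i ti]; last by rewrite mem_undup mem_cat ti orbT.
  rewrite scaler_sumr -big_split; apply: eq_bigr => i _ /=.
  by rewrite scalerDl scalerA.
- move=> _ [s [a [us ->]]]; apply: subspace_sum => // i _.
  exact: subspaceZ.
(* Modulo [Z j] only the [j]-th term survives, so a combination lying in [Y] has [a j = 0]. *)
- move=> _ [s [a [us ->]]] Ys; apply: big1_seq => j /= js.
  have [->|aj0] := eqVneq (a j) 0; first by rewrite scale0r.
  exfalso; apply: (nZv j); have := YZ j _ Ys.
  rewrite (bigD1_seq j) //= => Zs.
  have Zr : Z j (\sum_(i <- s | i != j) a i *: v i).
    rewrite -big_filter; apply: subspace_sum => // i.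
    rewrite mem_filter => /andP[ij _]; apply: subspaceZ => //.
    by apply: Zv; rewrite eq_sym.
  have := subspaceZ (a j)^-1 (sZ j) (subspaceB (sZ j) Zs Zr).
  by rewrite addrK scalerA mulVf // scale1r.
- exists V; split=> // i; apply: V0V.
  by exists [:: i], (fun=> 1); rewrite big_seq1 scale1r.
Qed.

End Subspaces.

(** * The modulus and complex differentiability *)

Section ComplexPlane.
Context {R : realType}.
Local Open Scope complex_scope.
Implicit Types (z w h : R[i]) (x y r t : R).

Lemma normcE_modulus z : `|z| = (modulus z)%:C.
Proof. by rewrite /modulus normc_def. Qed.

Lemma modulusE z : modulus z = Num.sqrt (complex.Re z ^+ 2 + complex.Im z ^+ 2).
Proof. by rewrite /modulus normc_def. Qed.

Lemma modulus_ge0 z : 0 <= modulus z.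
Proof. by rewrite modulusE sqrtr_ge0. Qed.

Lemma sqr_modulus z : modulus z ^+ 2 = complex.Re z ^+ 2 + complex.Im z ^+ 2.
Proof. by rewrite modulusE sqr_sqrtr // addr_ge0 ?sqr_ge0. Qed.

Lemma modulus0 : modulus 0 = 0 :> R.
Proof. by rewrite modulusE /= expr0n /= addr0 sqrtr0. Qed.

Lemma modulus1 : modulus 1 = 1 :> R.
Proof. by rewrite modulusE /= expr0n /= addr0 expr1n sqrtr1. Qed.

Lemma modulusM z w : modulus (z * w) = modulus z * modulus w.
Proof. by apply: complexI; rewrite rmorphM /= -!normcE_modulus normrM. Qed.

Lemma modulusV z : modulus z^-1 = (modulus z)^-1.
Proof. by apply: complexI; rewrite fmorphV /= -!normcE_modulus normfV. Qed.

Lemma modulusN z : modulus (- z) = modulus z.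
Proof. by apply: complexI; rewrite -!normcE_modulus normrN. Qed.

Lemma ler_modulusD z w : modulus (z + w) <= modulus z + modulus w.
Proof. by rewrite -lecR rmorphD /= -!normcE_modulus ler_normD. Qed.

Lemma ler_modulusB z w : modulus (z - w) <= modulus z + modulus w.
Proof. by rewrite (le_trans (ler_modulusD _ _)) // modulusN. Qed.

Lemma modulus_real x : modulus x%:C = `|x|.
Proof. by rewrite modulusE /= expr0n /= addr0 sqrtr_sqr. Qed.

Lemma modulus_eq0 z : (modulus z == 0) = (z == 0).
Proof.
by rewrite -[RHS]normr_eq0 normcE_modulus eq_complex /= eqxx andbT.
Qed.

Lemma ler_Re_modulus z : `|complex.Re z| <= modulus z.
Proof.
by rewrite modulusE -sqrtr_sqr ler_wsqrtr // lerDl sqr_ge0.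
Qed.

Lemma ler_Im_modulus z : `|complex.Im z| <= modulus z.
Proof.
by rewrite modulusE -sqrtr_sqr ler_wsqrtr // lerDr sqr_ge0.
Qed.

Lemma modulus_le_ReIm z : modulus z <= `|complex.Re z| + `|complex.Im z|.
Proof.
case: z => x y; rewrite modulusE /=.
rewrite -[leRHS]ger0_norm ?addr_ge0 // -sqrtr_sqr ler_wsqrtr //.
by rewrite sqrrD !real_normK ?num_real // lerD2r lerDl mulrn_wge0 // mulr_ge0.
Qed.

Lemma unit_discE z : unit_disc z <-> modulus z < 1.
Proof. by rewrite /unit_disc /= normcE_modulus ltcR. Qed.

Lemma complex_gt0 (e : R[i]) : 0 < e -> e = (complex.Re e)%:C /\ 0 < complex.Re e.
Proof. by case: e => x y; rewrite ltcE /= => /andP[/eqP -> ->]. Qed.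

Lemma cvg_modulusP (T : Type) (F : set_system T) (FF : Filter F)
    (f : T -> R[i]^o) (l : R[i]^o) :
  f @ F --> l <-> forall e : R, 0 < e -> \forall t \near F, modulus (l - f t) < e.
Proof.
split=> [/cvgrPdist_lt fl e e0|fl].
  have := fl e%:C; rewrite ltcR => /(_ e0); apply: filterS => t.
  by rewrite normcE_modulus ltcR.
apply/cvgrPdist_lt => e /complex_gt0[-> e0]; apply: filterS (fl _ e0) => t.
by rewrite [ `|_| ]normcE_modulus ltcR.
Qed.

Lemma near_modulusP (z : R[i]^o) (P : R[i]^o -> Prop) :
  (\forall w \near z, P w) <->
  exists2 e : R, 0 < e & forall w, modulus (z - w) < e -> P w.
Proof.
split.
  move=> /nbhs_normP[e /= /complex_gt0[-> e0] eP]; exists (complex.Re e) => // w we.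
  by apply: eP => /=; rewrite normcE_modulus ltcR.
move=> [e e0 eP]; apply/nbhs_normP; exists e%:C; first by rewrite /= ltcR.
by move=> w /=; rewrite normcE_modulus ltcR; exact: eP.
Qed.

(** Exponential and logarithm are given below by real formulas; a second-order remainder bound
    yields their complex differentiability directly, without the Cauchy-Riemann equations. *)
Lemma derivable_quadratic (f : R[i]^o -> R[i]^o) (z : R[i]^o) (d : R[i]) (k e : R) :
  0 < e -> (forall h : R[i], modulus h < e ->
    modulus (f (z + h) - f z - h * d) <= k * modulus h ^+ 2) ->
  derivable f z 1.
Proof.
move=> e0 fd; apply/cvg_ex; exists (d : R[i]^o); apply/cvg_modulusP => c c0.
have k1 : 0 < `|k| + 1 by rewrite ltr_wpDl.
apply/nbhs_normP; exists (Num.min e (c / (`|k| + 1)))%:C => /=.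
  by rewrite ltcR lt_min e0 divr_gt0.
move=> h /=; rewrite sub0r normrN normcE_modulus ltcR lt_min => /andP[he hc] h0.
have mh0 : 0 < modulus h by rewrite lt_neqAle modulus_ge0 andbT eq_sym modulus_eq0.
have -> : d - h^-1 *: (f (h *: (1 : R[i]^o) + z) - f z) =
   - (h^-1 * (f (z + h) - f z - h * d)).
  rewrite mulrBr mulKf // opprB; congr (_ - _ * (f _ - _)).
  by rewrite addrC; congr (_ + _); exact: mulr1.
rewrite modulusN modulusM modulusV mulrC ltr_pdivrMr //.
apply: (le_lt_trans (fd _ he)); rewrite expr2 mulrA ltr_pM2r //.
apply: (@le_lt_trans _ _ (`|k| * modulus h)).
  by rewrite ler_wpM2r ?modulus_ge0 // ler_norm.
rewrite ltr_pdivlMr // mulrC in hc; apply: le_lt_trans hc.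
by rewrite ler_wpM2r ?modulus_ge0 // lerDl.
Qed.

End ComplexPlane.

(** * Complex exponential and logarithm *)

Section RealEstimates.
Context {R : realType}.
Implicit Types (x y u t : R).

Lemma mean_value (f df : R -> R) x : (forall t, is_derive t 1 f (df t)) ->
  exists2 c, `|c| <= `|x| & f x - f 0 = df c * x.
Proof.
move=> fdf.
have fc a b : {within `[a, b], continuous f}.
  by apply: derivable_within_continuous => t _; apply: ex_derive.
have [x0|x0] := leP 0 x.
  have [c c0x ->] := MVT_segment x0 (fun t _ => fdf t) (fc 0 x).
  exists c; last by rewrite subr0.
  by move: c0x; rewrite in_itv /= => /andP[c0 cx]; rewrite !ger0_norm.
have [c c0x E] := MVT_segment (ltW x0) (fun t _ => fdf t) (fc x 0).
exists c; last by rewrite -opprB E sub0r mulrN opprK.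
move: c0x; rewrite in_itv /= => /andP[xc c0].
by rewrite !ler0_norm ?lerN2 // ltW.
Qed.

Lemma ler_norm_sin x : `|sin x| <= `|x|.
Proof.
have [c _] := mean_value x (@is_derive_sin R).
rewrite sin0 subr0 => ->; rewrite normrM.
by rewrite ler_piMl // cos_max.
Qed.

Lemma cos_half_sin x : cos x = 1 - sin (x / 2) ^+ 2 *+ 2.
Proof.
have -> : cos x = cos ((x / 2) *+ 2) by congr cos; rewrite mulr2n; lra.
by rewrite cos_mulr2n cos2sin2 mulrnBl; ring.
Qed.

Lemma cos_quadratic x : 1 - x ^+ 2 / 2 <= cos x.
Proof.
rewrite cos_half_sin; have : sin (x / 2) ^+ 2 <= (x / 2) ^+ 2.
  by rewrite -real_normK ?num_real // -[leRHS]real_normK ?num_real //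
    lerXn2r ?nnegrE // ler_norm_sin.
by rewrite -mulr_natr; nra.
Qed.

Lemma sin_quadratic x : `|x| <= 1 -> `|sin x - x| <= x ^+ 2.
Proof.
move=> x1; have [c cx] := mean_value x (@is_derive_sin R).
rewrite sin0 subr0 => ->.
have -> : cos c * x - x = - (1 - cos c) * x by ring.
rewrite normrM normrN -[leRHS]real_normK ?num_real // [leRHS]expr2 ler_wpM2r //.
have := cos_quadratic c; have := cos_le1 c => c1 c2.
rewrite [ `|1 - _|]ger0_norm ?subr_ge0 //.
have : c ^+ 2 <= `|x| ^+ 2 by rewrite -real_normK ?num_real // lerXn2r ?nnegrE.
have : `|x| ^+ 2 <= `|x| by rewrite expr2 ler_piMr.
by have := normr_ge0 x; lra.
Qed.

Lemma atan_quadratic x : `|x| <= 1 -> `|atan x - x| <= x ^+ 2.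
Proof.
move=> x1; have [c cx] := mean_value x (@is_derive1_atan R).
rewrite atan0 subr0 => ->.
have c21 : 0 < 1 + c ^+ 2 by rewrite ltr_wpDr // sqr_ge0.
have -> : (1 + c ^+ 2)^-1 * x - x = - (c ^+ 2 / (1 + c ^+ 2)) * x.
  by field; rewrite gt_eqF.
rewrite normrM normrN -[leRHS]real_normK ?num_real // [leRHS]expr2 ler_wpM2r //.
have q0 : 0 <= c ^+ 2 / (1 + c ^+ 2) by rewrite divr_ge0 ?sqr_ge0 // ltW.
rewrite (ger0_norm q0) ler_pdivrMr //.
have : c ^+ 2 <= `|x| ^+ 2 by rewrite -real_normK ?num_real // lerXn2r ?nnegrE.
have : `|x| ^+ 2 <= `|x| by rewrite expr2 ler_piMr.
have : 0 <= `|x| * c ^+ 2 by rewrite mulr_ge0 // sqr_ge0.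
lra.
Qed.

(** The inequality 1 + x <= exp x, used at x and at - x, squeezes exp x between 1 + x and 1 / (1 -
    x), and the latter is at most 1 + x + 2 x^2 when x <= 1/2. *)
Lemma expR_quadratic x : `|x| <= 1 / 2 -> `|expR x - 1 - x| <= 2 * x ^+ 2.
Proof.
rewrite ler_norml => /andP[x1 x2].
have E1 := expR_ge1Dx x; have E2 := expR_ge1Dx (- x).
have E3 : expR x <= (1 - x)^-1.
  rewrite -[expR x]invrK -expRN lef_pV2 ?posrE ?expR_gt0 //; lra.
have E4 : (1 - x)^-1 <= 1 + x + 2 * x ^+ 2.
  rewrite -[leLHS]mul1r ler_pdivrMr; nra.
by rewrite ger0_norm; lra.
Qed.

Lemma ln1D_quadratic t : `|t| <= 1 / 2 -> `|ln (1 + t) - t| <= 2 * t ^+ 2.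
Proof.
rewrite ler_norml => /andP[t1 t2].
have L1 : ln (1 + t) <= t by apply: le_ln1Dx; lra.
have t0 : 0 < 1 + t by lra.
have L2 : - ln (1 + t) <= - (t / (1 + t)).
  rewrite -lnV ?posrE //.
  have E : (1 + t)^-1 = 1 + - (t / (1 + t)) by field; rewrite gt_eqF.
  rewrite [in leLHS]E.
  apply: le_ln1Dx; rewrite ltrNr opprK ltr_pdivrMr //; lra.
have L3 : t - t / (1 + t) <= 2 * t ^+ 2.
  have -> : t - t / (1 + t) = t ^+ 2 / (1 + t) by field; rewrite gt_eqF.
  rewrite ler_pdivrMr //; have := sqr_ge0 t; nra.
rewrite ler0_norm; lra.
Qed.

Lemma ln_sqrt x : 0 < x -> ln (Num.sqrt x) = ln x / 2.
Proof.
move=> x0; have s0 : 0 < Num.sqrt x by rewrite sqrtr_gt0.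
by rewrite -[in RHS](sqr_sqrtr (ltW x0)) lnXn // mulr2n; lra.
Qed.

Lemma sin_atan x : sin (atan x) = x * cos (atan x).
Proof.
have c0 : cos (atan x) != 0.
  by rewrite gt_eqF // cos_gt0_pihalf // atan_gtNpi2 atan_ltpi2.
by rewrite -[X in _ = X * _](atanK x) /tan divfK.
Qed.

End RealEstimates.

Section ComplexLogarithm.
Context {R : realType}.
Local Open Scope complex_scope.
Implicit Types (z w h : R[i]).

Definition cexp z : R[i] :=
  (expR (complex.Re z) * cos (complex.Im z)) +i*
  (expR (complex.Re z) * sin (complex.Im z)).

(* Only meaningful on the half plane [0 < Re z]. *)
Definition clog z : R[i] :=
  ln (modulus z) +i* atan (complex.Im z / complex.Re z).

Lemma cexpD z w : cexp (z + w) = cexp z * cexp w.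
Proof.
case: z w => [x y] [u v]; rewrite /cexp /= expRD cosD sinD; simpc.
by apply/eqP; rewrite eq_complex /=; apply/andP; split; apply/eqP; ring.
Qed.

Lemma modulus_cexp z : modulus (cexp z) = expR (complex.Re z).
Proof.
by rewrite modulusE /= !exprMn -mulrDr cos2Dsin2 mulr1 sqrtr_sqr ger0_norm.
Qed.

Lemma Re_modulus_gt0 z : 0 < complex.Re z -> 0 < modulus z.
Proof. by move=> z0; rewrite (lt_le_trans z0) // (le_trans _ (ler_Re_modulus z)) // ler_norm. Qed.

Lemma cos_clog z : 0 < complex.Re z ->
  cos (complex.Im (clog z)) = complex.Re z / modulus z.
Proof.
move=> z0; have m0 := Re_modulus_gt0 z0.
rewrite /= cos_atan.
have -> : 1 + (complex.Im z / complex.Re z) ^+ 2 = (modulus z / complex.Re z) ^+ 2.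
  by rewrite !expr_div_n sqr_modulus; field; rewrite gt_eqF.
by rewrite sqrtr_sqr ger0_norm ?divr_ge0 ?ltW // invf_div.
Qed.

Lemma sin_clog z : 0 < complex.Re z ->
  sin (complex.Im (clog z)) = complex.Im z / modulus z.
Proof.
move=> z0; have m0 := Re_modulus_gt0 z0.
have := cos_clog z0; rewrite /= sin_atan => ->.
by field; rewrite !gt_eqF.
Qed.

(** The sum of the two arguments and the argument of the product have the same sine and cosine. The
    sum lies in ]-pi, pi[, and its positive cosine confines it to ]-pi/2, pi/2[, where sine is
    injective. *)
Lemma clogM z w : 0 < complex.Re z -> 0 < complex.Re w ->
  0 < complex.Re (z * w) -> clog (z * w) = clog z + clog w.
Proof.
move=> z0 w0 zw0.
have mz := Re_modulus_gt0 z0; have mw := Re_modulus_gt0 w0.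
have bnd (v : R[i]) : - (pi / 2) < complex.Im (clog v) < pi / 2.
  by rewrite /= atan_gtNpi2 atan_ltpi2.
have cs : cos (complex.Im (clog z) + complex.Im (clog w)) = cos (complex.Im (clog (z * w))).
  rewrite cosD !cos_clog // !sin_clog // modulusM.
  by case: z w {z0 w0 zw0 bnd} mz mw => [x y] [u v] mz mw; simpc => /=; field; rewrite !gt_eqF.
have sn : sin (complex.Im (clog z) + complex.Im (clog w)) = sin (complex.Im (clog (z * w))).
  rewrite sinD !cos_clog // !sin_clog // modulusM.
  by case: z w {z0 w0 zw0 bnd cs} mz mw => [x y] [u v] mz mw; simpc => /=; field; rewrite !gt_eqF.
have := bnd z; have := bnd w; have := bnd (z * w).
set s := complex.Im (clog z) in cs sn *; set t := complex.Im (clog w) in cs sn *.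
set r := complex.Im (clog (z * w)) in cs sn *.
move=> /andP[r1 r2] /andP[t1 t2] /andP[s1 s2].
suff E : s + t = r.
  rewrite [LHS]/clog -[atan _]/r -E modulusM lnM ?posrE //.
have c0 : 0 < cos (s + t) by rewrite cs cos_gt0_pihalf // r1 r2.
have st_lt x : - pi < x < pi -> 0 < cos x -> x < pi / 2.
  move=> /andP[x1 x2] cx; rewrite ltNge; apply/negP => x3.
  move: cx; rewrite ltNge => /negP; apply; rewrite -cos_pihalf.
  have [->//|x3'] := eqVneq x (pi / 2).
  have x4 : pi / 2 < x by rewrite lt_neqAle eq_sym x3' x3.
  have p := @pi_gt0 R.
  by apply/ltW; rewrite ltr_cos // in_itv /=; apply/andP; split; lra.
apply: sin_inj => //; rewrite in_itv /=; last by rewrite !ltW.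
have p := @pi_gt0 R.
apply/andP; split; last first.
  by apply/ltW/st_lt => //; apply/andP; split; lra.
by rewrite lerNl; apply/ltW/st_lt; rewrite ?cosN //; apply/andP; split; lra.
Qed.

Lemma cexp_quadratic h : modulus h < 1 / 2 ->
  modulus (cexp h - 1 - h) <= 8 * modulus h ^+ 2.
Proof.
move=> h1; have := sqr_modulus h; have := ler_Re_modulus h; have := ler_Im_modulus h.
case: h h1 => x y h1 /= yh xh mh.
have x1 : `|x| <= 1 / 2 by lra.
have y1 : `|y| <= 1 by lra.
have ex := expR_quadratic x1.
have sy := sin_quadratic y1.
have cy := cos_quadratic y; have cy1 := cos_le1 y.
rewrite (le_trans (modulus_le_ReIm _)) //= mh.
have ex3 : `|expR x - 1| <= 2 * `|x|.
  have -> : expR x - 1 = (expR x - 1 - x) + x by ring.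
  rewrite (le_trans (ler_normD _ _)) // (_ : 2 * `|x| = `|x| + `|x|); last by ring.
  rewrite lerD2r (le_trans ex) //.
  rewrite -real_normK ?num_real //; have := normr_ge0 x; nra.
(* Both parts are split so that every summand is of second order. *)
have E1 : expR x * cos y - 1 - x = (expR x - 1 - x) + expR x * (cos y - 1) by ring.
have E2 : expR x * sin y - 0 - y = (expR x - 1) * y + expR x * (sin y - y) by ring.
have e2 : expR x <= 2.
  by move: ex3; rewrite ler_norml => /andP[_]; have := ler_norm x; lra.
have ex0 := expR_gt0 x.
have A1 : `|expR x * (cos y - 1)| <= y ^+ 2.
  rewrite normrM gtr0_norm // ler0_norm ?subr_le0 // opprB; nra.
have A2 : `|expR x * (sin y - y)| <= 2 * y ^+ 2.
  rewrite normrM gtr0_norm //; apply: ler_pM => //; exact: ltW.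
have A3 : `|(expR x - 1) * y| <= x ^+ 2 + y ^+ 2.
  rewrite normrM (le_trans (ler_wpM2r _ ex3)) // -[x ^+ 2]real_normK ?num_real //.
  rewrite -[y ^+ 2]real_normK ?num_real //; have := sqr_ge0 (`|x| - `|y|); nra.
rewrite E1 E2.
have := ler_normD (expR x - 1 - x) (expR x * (cos y - 1)).
have := ler_normD ((expR x - 1) * y) (expR x * (sin y - y)).
have := sqr_ge0 x; have := sqr_ge0 y; lra.
Qed.

Lemma clog1_quadratic h : modulus h < 1 / 8 ->
  modulus (clog (1 + h) - h) <= 32 * modulus h ^+ 2.
Proof.
move=> h1; have := sqr_modulus h; have := ler_Re_modulus h; have := ler_Im_modulus h.
have m0 := modulus_ge0 h.
case: h h1 m0 => x y h1 m0 /= yh xh mh.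
rewrite (le_trans (modulus_le_ReIm _)) //=.
rewrite modulusE /= add0r.
set m := modulus _ in h1 m0 yh xh mh *.
(* Here |1 + h|^2 = 1 + t with t of first order in m, so the real part of the logarithm is ln (1 +
   t) / 2; its imaginary part is the arctangent of u = y / (1 + x). *)
pose t := 2 * x + m ^+ 2.
have -> : (1 + x) ^+ 2 + y ^+ 2 = 1 + t by rewrite /t mh; ring.
have tm : `|t| <= 3 * m.
  rewrite /t (le_trans (ler_normD _ _)) // normrM ger0_norm //.
  rewrite [ `|_ ^+ 2|]ger0_norm ?sqr_ge0 //; nra.
have t1 : `|t| <= 1 / 2 by lra.
have lt := ln1D_quadratic t1.
have t2 : t ^+ 2 <= 9 * m ^+ 2.
  rewrite -real_normK ?num_real //; have := normr_ge0 t; nra.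
rewrite ln_sqrt; last by move: t1; rewrite ler_norml => /andP[]; lra.
have A1 : `|ln (1 + t) / 2 - x| <= 10 * m ^+ 2.
  have -> : ln (1 + t) / 2 - x = (ln (1 + t) - t) / 2 + m ^+ 2 / 2 by rewrite /t; field.
  rewrite (le_trans (ler_normD _ _)) //.
  rewrite [ `|m ^+ 2 / 2|]ger0_norm ?divr_ge0 ?sqr_ge0 //.
  by rewrite normrM [ `|2^-1|]ger0_norm ?invr_ge0 //; have := sqr_ge0 m; lra.
have [x1 x2] : - (1 / 8) <= x /\ x <= 1 / 8.
  by move: xh; rewrite ler_norml => /andP[? ?]; split; lra.
have x10 : 0 < 1 + x by lra.
pose u := y / (1 + x).
have uy : `|u| <= 2 * `|y|.
  rewrite /u normrM normfV [ `|1 + x|]gtr0_norm // ler_pdivrMr //.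
  have := normr_ge0 y; nra.
have u1 : `|u| <= 1 by lra.
have au := atan_quadratic u1.
have u2 : u ^+ 2 <= 4 * m ^+ 2.
  rewrite -real_normK ?num_real //; have := normr_ge0 u; nra.
have A2 : `|u - y| <= 2 * m ^+ 2.
  have -> : u - y = - (x * u) by rewrite /u; field; rewrite gt_eqF.
  rewrite normrN normrM; have := normr_ge0 u; have := normr_ge0 x; nra.
have -> : atan (y / (1 + x)) - y = (atan u - u) + (u - y) by rewrite /u; ring.
have := ler_normD (atan u - u) (u - y).
have := sqr_ge0 m; lra.
Qed.

Lemma derivable_cexp (z : R[i]^o) : derivable (cexp : R[i]^o -> R[i]^o) z 1.
Proof.
apply: (@derivable_quadratic _ _ _ (cexp z) (modulus (cexp z) * 8) (1 / 2)) => // h h1.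
have -> : cexp (z + h) - cexp z - h * cexp z = cexp z * (cexp h - 1 - h).
  by rewrite cexpD; ring.
rewrite modulusM -mulrA ler_wpM2l ?modulus_ge0 //; exact: cexp_quadratic.
Qed.

Lemma derivable_clog (z : R[i]^o) : 0 < complex.Re z ->
  derivable (clog : R[i]^o -> R[i]^o) z 1.
Proof.
move=> z0; have mz := Re_modulus_gt0 z0.
have nz : (z : R[i]) != 0 by rewrite -modulus_eq0 gt_eqF.
(* The first bound keeps z + h in the right half plane, the second puts h / z in the range of
   [clog1_quadratic]; [clogM] then moves the estimate from z to 1. *)
pose e := Num.min (complex.Re z) (modulus z / 8).
apply: (@derivable_quadratic _ _ _ z^-1 (32 / modulus z ^+ 2) e).
  by rewrite lt_min z0 divr_gt0.
move=> h; rewrite lt_min => /andP[h1 h2].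
pose w := h / z.
have zw : z + h = z * (1 + w) by rewrite mulrDr mulr1 mulrC /w divfK.
have mw : modulus w < 1 / 8.
  by rewrite modulusM modulusV ltr_pdivrMr // mul1r mulrC.
have -> : clog (z + h) - clog z - h * z^-1 = clog (1 + w) - w.
  rewrite zw clogM //; first by rewrite /w; ring.
    by have := ler_Re_modulus w; rewrite ler_norml raddfD /= => /andP[]; lra.
  rewrite -zw raddfD /=; have := ler_Re_modulus h; rewrite ler_norml => /andP[]; lra.
rewrite (le_trans (clog1_quadratic mw)) // /w modulusM modulusV expr_div_n.
by rewrite mulrA mulrAC.
Qed.

End ComplexLogarithm.

(** * Local Hardy spaces as vector spaces *)

Section HardySubspaces.
Context {R : realType}.
Local Open Scope complex_scope.
Local Notation C := (R[i]).
Local Notation cfun := (C -> C^o).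
Local Notation mu := (@lebesgue_measure R).
Implicit Types (f g : cfun) (s a b r t : R) (c z w : C).

Lemma unit_disc_nbhs (z : C^o) : unit_disc z -> \forall w \near z, unit_disc (w : C).
Proof.
move=> /unit_discE z1; apply/near_modulusP; exists (1 - modulus z).
  by rewrite subr_gt0.
move=> w zw; apply/unit_discE; have -> : w = z - (z - w) by ring.
by rewrite (le_lt_trans (ler_modulusB _ _)) // -ltrBrDl.
Qed.

Lemma holomorphic_disc0 : @holomorphic_disc R (fun=> 0).
Proof. by split=> // z _; exact: derivable_cst. Qed.

Lemma holomorphic_disc_lincomb c f g : holomorphic_disc f -> holomorphic_disc g ->
  holomorphic_disc (fun z => c * f z + g z).
Proof.
move=> [df f0] [dg g0]; split=> [z z1|z z1]; last by rewrite f0 // g0 // mulr0 addr0.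
apply: (@derivableD _ C^o C^o (c \*: f) g); last exact: dg.
by apply: derivableZ; exact: df.
Qed.

Lemma holomorphic_continuous f z : holomorphic_disc f -> unit_disc z ->
  {for (z : C^o), continuous (f : C^o -> C^o)}.
Proof.
by move=> [df _] z1; apply/differentiable_continuous/derivable1_diffP; exact: df.
Qed.

Lemma modulus_cpolar r t : 0 <= r -> modulus (cpolar r t) = r.
Proof.
move=> r0; rewrite modulusE /= !exprMn -mulrDr cos2Dsin2 mulr1 sqrtr_sqr.
by rewrite ger0_norm.
Qed.

Lemma cpolar_disc r t : 0 < r < 1 -> unit_disc (cpolar r t).
Proof. by move=> /andP[r0 r1]; apply/unit_discE; rewrite modulus_cpolar // ltW. Qed.

Lemma cpolar_continuous r : continuous (cpolar r : R -> C^o).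
Proof.
move=> t; apply/cvg_modulusP => e e0.
have cvgr (g : R -> R) : continuous g ->
    \forall x \near t, `|r * g t - r * g x| < e / 2.
  move=> gc; have /cvgrPdist_lt : r * g x @[x --> t] --> r * g t.
    by apply: cvgM; [exact: cvg_cst|exact: gc].
  by apply; rewrite divr_gt0.
near=> x; rewrite (le_lt_trans (modulus_le_ReIm _)) // [e]splitr ltrD //=.
  by near: x; apply: cvgr; exact: continuous_cos.
by near: x; apply: cvgr; exact: continuous_sin.
Unshelve. all: by end_near. Qed.

Lemma continuous_modulus : continuous (@modulus R : C^o -> R).
Proof.
move=> z; apply/(@cvgrPdist_lt _ _ _ (nbhs (z : C^o))) => e e0.
apply/near_modulusP; exists e => // w; apply: le_lt_trans; rewrite ler_norml; apply/andP; split.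
  rewrite lerNl opprB lerBlDr.
  by rewrite -[modulus (_ - _)]modulusN opprB (le_trans _ (ler_modulusD _ _)) ?subrK.
by rewrite lerBlDr (le_trans _ (ler_modulusD _ _)) // subrK.
Qed.

Lemma circle_continuous f r : holomorphic_disc f -> 0 < r < 1 ->
  continuous (fun t => modulus (f (cpolar r t))).
Proof.
move=> hf r01 t; apply: (@continuous_comp _ C^o _ (fun t => f (cpolar r t)) (@modulus R)).
  apply: (@continuous_comp _ C^o C^o (cpolar r) f); first exact: cpolar_continuous.
  exact: holomorphic_continuous (cpolar_disc _ r01).
exact: continuous_modulus.
Qed.

Lemma circle_measurable f r s : holomorphic_disc f -> 0 < r < 1 ->
  measurable_fun setT (fun t => modulus (f (cpolar r t)) `^ s).
Proof.
move=> hf r01.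
apply: (@measurableT_comp _ _ _ _ _ _ (@powR R ^~ s)) => //.
by apply: continuous_measurable_fun; exact: circle_continuous.
Qed.

Lemma ler_integral_lincomb (D : set R) (u v w : R -> R) (k l : R) :
  measurable D -> 0 <= k -> 0 <= l ->
  measurable_fun setT u -> measurable_fun setT v -> measurable_fun setT w ->
  (forall t, 0 <= u t) -> (forall t, 0 <= v t) -> (forall t, 0 <= w t) ->
  (forall t, D t -> w t <= k * u t + l * v t) ->
  (\int[mu]_(t in D) (w t)%:E <=
   k%:E * \int[mu]_(t in D) (u t)%:E + l%:E * \int[mu]_(t in D) (v t)%:E)%E.
Proof.
move=> mD k0 l0 mu_ mv mw u0 v0 w0 wuv.
have mE (g : R -> R) : measurable_fun setT g -> measurable_fun D (fun t => (g t)%:E).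
  by move=> mg; apply/measurable_EFinP; exact: measurable_funS mg.
have E (g : R -> R) (c : R) : 0 <= c -> (forall t, 0 <= g t) -> measurable_fun setT g ->
    (c%:E * \int[mu]_(t in D) (g t)%:E = \int[mu]_(t in D) (c * g t)%:E)%E.
  move=> c0 g0 mg; rewrite -ge0_integralZl_EFin // => [t _|]; last exact: (mE _ mg).
  by rewrite lee_fin.
have mk (g : R -> R) (c : R) : measurable_fun setT g ->
    measurable_fun setT (fun t => c * g t) by move=> mg; exact: measurable_funM.
rewrite !E // -ge0_integralD //; first last.
- exact: (mE _ (mk _ _ _)).
- by move=> t _; rewrite lee_fin mulr_ge0.
- exact: (mE _ (mk _ _ _)).
- by move=> t _; rewrite lee_fin mulr_ge0.
apply: ge0_le_integral => //.
- by move=> t _; rewrite lee_fin.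
- exact: (mE w).
- by apply: (mE (fun t => k * u t + l * v t)); apply: measurable_funD; exact: mk.
Qed.

(** The sum is at most twice the larger term; unlike convexity, this also covers q < 1. *)
Lemma powR_lincomb (q x y : R) : 0 < q -> 0 <= x -> 0 <= y ->
  (x + y) `^ q <= 2 `^ q * (x `^ q + y `^ q).
Proof.
move=> q0; wlog xy : x y / x <= y => [W|] x0 y0.
  have [|/ltW] := leP x y; first by move=> ?; exact: W.
  by move=> ?; rewrite addrC [_ `^ q + _]addrC; exact: W.
apply: (@le_trans _ _ ((2 * y) `^ q)).
  apply: ge0_ler_powR; rewrite ?nnegrE ?mulr_ge0 ?addr_ge0 ?(ltW q0) //.
  by rewrite [2 * y](_ : _ = y + y) ?lerD2r //; ring.
by rewrite powRM // ler_wpM2l ?powR_ge0 // lerDr powR_ge0.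
Qed.

Lemma radial_mean_ltyP s a b f : (radial_mean s a b f < +oo)%E <->
  exists M : R, forall r, 0 < r < 1 ->
    (\int[mu]_(t in `[a, b]) (modulus (f (cpolar r t)) `^ s)%:E <= M%:E)%E.
Proof.
split=> [flty|[M fM]]; last first.
  apply: (@le_lt_trans _ _ M%:E); last exact: ltry.
  by apply/ereal_supP => _ [r /= r01 <-]; apply: fM; rewrite in_itv /= in r01.
have ge0 r : 0 < r < 1 -> (0 <= radial_mean s a b f)%E.
  move=> r01; apply: le_ereal_sup_tmp; eexists; first by exists r; rewrite ?in_itv.
  by apply: integral_ge0 => t _; rewrite lee_fin powR_ge0.
exists (fine (radial_mean s a b f)) => r r01.
rewrite fineK; last by rewrite ge0_fin_numE // (ge0 r).
by apply: ereal_sup_ubound; exists r; rewrite ?in_itv.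
Qed.

Lemma radial_sup_ltyP a b f : (radial_sup a b f < +oo)%E <->
  exists M : R, forall r t, 0 < r < 1 -> a <= t <= b ->
    modulus (f (cpolar r t)) <= M.
Proof.
split=> [flty|[M fM]]; last first.
  apply: (@le_lt_trans _ _ M%:E); last exact: ltry.
  apply/ereal_supP => _ [r /= r01 <-]; apply/ereal_supP => _ [t /= tab <-].
  by rewrite lee_fin; apply: fM; [rewrite in_itv /= in r01|rewrite in_itv /= in tab].
have le r t : 0 < r < 1 -> a <= t <= b ->
    ((modulus (f (cpolar r t)))%:E <= radial_sup a b f)%E.
  move=> r01 tab; apply: le_ereal_sup_tmp; eexists; first by exists r; rewrite ?in_itv.
  by apply: ereal_sup_ubound; exists t; rewrite /= ?in_itv.
exists (fine (radial_sup a b f)) => r t r01 tab.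
have := le _ _ r01 tab; rewrite -lee_fin fineK // ge0_fin_numE //.
by apply: le_trans (le _ _ r01 tab); rewrite lee_fin modulus_ge0.
Qed.

Lemma radial_mean_lincomb s a b c f g : 0 < s ->
  holomorphic_disc f -> holomorphic_disc g ->
  (radial_mean s a b f < +oo)%E -> (radial_mean s a b g < +oo)%E ->
  (radial_mean s a b (fun z => c * f z + g z)%R < +oo)%E.
Proof.
move=> s0 hf hg /radial_mean_ltyP[Mf fM] /radial_mean_ltyP[Mg gM].
apply/radial_mean_ltyP.
exists (2 `^ s * modulus c `^ s * Mf + 2 `^ s * Mg) => r r01.
apply: (@le_trans _ _ ((2 `^ s * modulus c `^ s)%:E *
    (\int[mu]_(t in `[a, b]) (modulus (f (cpolar r t)) `^ s)%:E) + (2 `^ s)%:E *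
    \int[mu]_(t in `[a, b]) (modulus (g (cpolar r t)) `^ s)%:E)%E).
  apply: ler_integral_lincomb => //; rewrite ?mulr_ge0 ?powR_ge0 //;
    try by move=> t; exact: powR_ge0.
  - exact: circle_measurable.
  - exact: circle_measurable.
  - exact: (circle_measurable s (holomorphic_disc_lincomb c hf hg) r01).
  move=> t _; rewrite -mulrA -powRM ?modulus_ge0 // -modulusM -mulrDr.
  apply: le_trans (powR_lincomb s0 (modulus_ge0 _) (modulus_ge0 _)).
  apply: ge0_ler_powR; rewrite ?nnegrE ?addr_ge0 ?modulus_ge0 ?(ltW s0) //.
  exact: ler_modulusD.
rewrite EFinD !EFinM; apply: leeD; apply: lee_wpmul2l;
  rewrite ?mule_ge0 ?lee_fin ?powR_ge0 //; [exact: fM|exact: gM].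
Qed.

Lemma local_hardy0 (q : \bar R) a b : (0 < q)%E -> local_hardy q a b (fun=> 0).
Proof.
case: q => [q| |] q0 //; split; try exact: holomorphic_disc0.
- apply/radial_mean_ltyP; exists 0 => r r01.
  by rewrite integral0_eq // => t _; rewrite modulus0 powR0 // gt_eqF.
- by apply/radial_sup_ltyP; exists 0 => r t _ _; rewrite modulus0.
Qed.

Lemma local_hardy_lincomb (q : \bar R) a b c f g : (0 < q)%E ->
  local_hardy q a b f -> local_hardy q a b g ->
  local_hardy q a b (fun z => c * f z + g z).
Proof.
case: q => [q| |]; last by move=> ?; exfalso.
- move=> q0 [hf fM] [hg gM]; split; first exact: holomorphic_disc_lincomb.
  exact: radial_mean_lincomb.
- move=> _ [hf /radial_sup_ltyP[Mf fM]] [hg /radial_sup_ltyP[Mg gM]].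
  split; first exact: holomorphic_disc_lincomb.
  apply/radial_sup_ltyP; exists (modulus c * Mf + Mg) => r t r01 tab.
  rewrite (le_trans (ler_modulusD _ _)) // modulusM lerD ?gM //.
  by rewrite ler_wpM2l ?modulus_ge0 // fM.
Qed.

Lemma local_hardy_subspace (q : \bar R) a b : (0 < q)%E ->
  subspace (local_hardy q a b : set (C -> C^o : lmodType C)).
Proof.
move=> q0; split; first exact: (local_hardy0 a b q0).
by move=> c f g hf hg; exact: (local_hardy_lincomb c q0 hf hg).
Qed.

Lemma local_hardy_subset (q : \bar R) (a b c d : R) : a <= c -> d <= b ->
  local_hardy q a b `<=` local_hardy q c d.
Proof.
move=> ac db f [hf]; case: q => [q| |]; last by [].
- move=> /radial_mean_ltyP[M fM]; split=> //; apply/radial_mean_ltyP.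
  exists M => r r01; apply: le_trans (fM _ r01); apply: ge0_subset_integral => //.
  + apply/measurable_EFinP; apply: measurable_funS (circle_measurable q hf r01) => //.
  + by move=> t _; rewrite lee_fin powR_ge0.
  + move=> t /=; rewrite !in_itv /= => /andP[ct td].
    by rewrite (le_trans ac ct) (le_trans td db).
- move=> /radial_sup_ltyP[M fM]; split=> //; apply/radial_sup_ltyP.
  exists M => r t r01 /andP[ct td]; apply: fM => //.
  by rewrite (le_trans ac ct) (le_trans td db).
Qed.

Lemma local_hardy_bounded (q : \bar R) a b f (M : R) : (0 < q)%E -> a <= b ->
  holomorphic_disc f ->
  (forall r t, 0 < r < 1 -> a <= t <= b -> modulus (f (cpolar r t)) <= M) ->
  local_hardy q a b f.
Proof.
move=> q0 ab hf fM; split=> //; case: q q0 => [q| |] // q0; last first.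
  by apply/radial_sup_ltyP; exists M.
apply/radial_mean_ltyP; exists (`|M| `^ q * (b - a)) => r r01.
apply: (@le_trans _ _ (\int[mu]_(t in `[a, b]) (cst (`|M| `^ q)%:E t))%E).
  apply: ge0_le_integral => //.
  - by move=> t _; rewrite lee_fin powR_ge0.
  - by apply/measurable_EFinP; apply: measurable_funS (circle_measurable q hf r01).
  move=> t /=; rewrite in_itv /= => tab; rewrite lee_fin.
  rewrite lte_fin in q0.
  apply: (ge0_ler_powR (ltW q0)); rewrite ?nnegrE ?modulus_ge0 //.
  by rewrite (le_trans (fM _ _ r01 tab)) // ler_norm.
rewrite integral_cst //= lebesgue_measure_itv /= lte_fin.
case: ltP => _; first by rewrite -EFinD -EFinM.
by rewrite mule0 lee_fin mulr_ge0 ?powR_ge0 // subr_ge0.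
Qed.

End HardySubspaces.

(** * Means of powers of the distance to the point 1 *)

Section PowerIntegrals.
Context {R : realType}.
Local Notation mu := (@lebesgue_measure R).
Implicit Types (a b c x y t u m e k r : R).

Lemma integral_derive (F f : R -> R) a b : a < b ->
  (forall t, a <= t <= b -> is_derive t 1 F (f t)) ->
  (forall t, a <= t <= b -> derivable f t 1) ->
  (\int[mu]_(t in `[a, b]) (f t)%:E = (F b - F a)%:E)%E.
Proof.
move=> ab dF df; rewrite EFinB; apply: continuous_FTC2 => //.
- apply: derivable_within_continuous => t; rewrite in_itv /= => tab.
  exact: df.
- have Fc t : a <= t <= b -> {for t, continuous F}.
    by move=> tab; apply/differentiable_continuous/derivable1_diffP; case: (dF t tab).
  split.
  + move=> t; rewrite in_itv /= => /andP[ta tb].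
    by have := dF t; rewrite !ltW // => /(_ isT) [].
  + by apply: cvg_at_right_filter; apply: Fc; rewrite lexx ltW.
  + by apply: cvg_at_left_filter; apply: Fc; rewrite lexx ltW.
- move=> t; rewrite in_itv /= => /andP[ta tb].
  by have := dF t; rewrite !ltW // => /(_ isT) ?; rewrite derive1E derive_val.
Qed.

Lemma is_derive_affine m k t : is_derive t 1 (fun x => m + k * x) k.
Proof.
have -> : (fun x => m + k * x) = cst m + k \*: id.
  by apply/funext => x.
apply: is_derive_eq; last by rewrite add0r /GRing.scale /= mulr1.
Qed.

Lemma integral_affine_powR m k g a b : a < b -> k != 0 -> g != 0 ->
  0 < m + k * a -> 0 < m + k * b ->
  (\int[mu]_(t in `[a, b]) ((m + k * t) `^ (g - 1))%:E =
   (((m + k * b) `^ g - (m + k * a) `^ g) / (k * g))%:E)%E.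
Proof.
move=> ab k0 g0 ma mb.
have pos t : a <= t <= b -> 0 < m + k * t.
  move=> /andP[ta tb]; have [k1|k1] := leP 0 k.
    by rewrite (lt_le_trans ma) // lerD2l ler_wpM2l.
  by rewrite (lt_le_trans mb) // lerD2l ler_wnM2l // ltW.
have dF t : a <= t <= b -> is_derive t 1 (fun t => (k * g)^-1 * (m + k * t) `^ g)
    ((m + k * t) `^ (g - 1)).
  move=> tab.
  have d1 := @is_derive1_comp _ (fun x => x `^ g) (fun x => m + k * x) t _ _
    (is_derive1_powR g (pos t tab)) (is_derive_affine m k t).
  have := is_deriveZ (k * g)^-1 d1.
  move/is_derive_eq; apply.
  by rewrite /GRing.scale /=; field; rewrite k0 g0.
have df t : a <= t <= b -> derivable (fun t => (m + k * t) `^ (g - 1)) t 1.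
  move=> tab.
  have d1 := @is_derive1_comp _ (fun x => x `^ (g - 1)) (fun x => m + k * x) t _ _
    (is_derive1_powR (g - 1) (pos t tab)) (is_derive_affine m k t).
  by case: d1.
by rewrite (integral_derive ab dF df) -mulrBr mulrC.
Qed.

Lemma integral_affine_inv m a b : a < b -> 0 < m + a ->
  (\int[mu]_(t in `[a, b]) ((m + 1 * t) `^ (-1))%:E =
   (ln (m + b) - ln (m + a))%:E)%E.
Proof.
move=> ab ma.
have pos t : a <= t <= b -> 0 < m + 1 * t.
  by move=> /andP[ta tb]; rewrite mul1r (lt_le_trans ma) // lerD2l.
have dF t : a <= t <= b -> is_derive t 1 (fun t => ln (m + 1 * t)) ((m + 1 * t) `^ (-1)).
  move=> tab.
  have d1 := @is_derive1_comp _ (@ln R) (fun x => m + 1 * x) t _ _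
    (is_derive1_ln (pos t tab)) (is_derive_affine m 1 t).
  by move/is_derive_eq: d1; apply; rewrite mulr1 powR_inv1 // ltW // pos.
have df t : a <= t <= b -> derivable (fun t => (m + 1 * t) `^ (-1)) t 1.
  move=> tab.
  have d1 := @is_derive1_comp _ (fun x => x `^ (-1)) (fun x => m + 1 * x) t _ _
    (is_derive1_powR (-1) (pos t tab)) (is_derive_affine m 1 t).
  by case: d1.
by rewrite (integral_derive ab dF df) !mul1r.
Qed.

Lemma continuous_singular_weight e c (beta : R) : 0 < e ->
  continuous (fun t => (e + `|t - c|) `^ (- beta)).
Proof.
move=> e0 t.
have pc : {for e + `|t - c|, continuous (fun x : R => x `^ (- beta))}.
  apply/differentiable_continuous/derivable1_diffP/derivable_powR.
  by rewrite in_itv /= andbT ltr_pwDl.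
apply: (@continuous_comp _ _ _ (fun t => e + `|t - c|) (fun x : R => x `^ (- beta))) => //.
apply: cvgD; first exact: cvg_cst.
by apply: cvg_norm; apply: cvgB; [exact: cvg_id|exact: cvg_cst].
Qed.

(** As beta < 1, the antiderivative of x^(-beta) stays bounded near 0, which makes the bound uniform
    in e. A bounded range of centres suffices, because angles are reduced modulo 2 pi later. *)
Lemma integral_singular_weight (beta B : R) : 0 < beta < 1 ->
  exists K : R, 0 <= K /\ forall c e, `|c| <= B -> 0 < e < 1 ->
  (\int[mu]_(t in `[0%R, (2 * pi)%R]) ((e + `|t - c|) `^ (- beta))%:E <= K%:E)%E.
Proof.
move=> /andP[b0 b1]; have p0 := @pi_gt0 R.
(* With this [M], the interval [c - M, c + M] covers [0, 2 pi] whenever |c| <= B. *)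
pose M := `|B| + 2 * pi + 1; have M0 : 0 < M by rewrite /M; have := normr_ge0 B; lra.
pose g := 1 - beta; have g0 : 0 < g by rewrite subr_gt0.
have gE : - beta = g - 1 by rewrite /g; ring.
pose K := (1 + M) `^ g / g.
have K0 : 0 <= K by rewrite divr_ge0 ?powR_ge0 // ltW.
exists (K + K); split; first by rewrite addr_ge0.
move=> c e cB /andP[e0 e1].
have [c1 c2] : - `|B| <= c /\ c <= `|B|.
  by apply/andP; rewrite -ler_norml (le_trans cB) // ler_norm.
have cM : c < c + M by lra.
have Mc : c - M < c by lra.
have side : ((e + M) `^ g - e `^ g) / g <= K.
  rewrite ler_wpM2r ?invr_ge0 ?(ltW g0) // lerBlDr ler_wpDr ?powR_ge0 //.
  by apply: ge0_ler_powR; rewrite ?nnegrE ?(ltW g0) //; lra.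
have mw (D : set R) : measurable D ->
    measurable_fun D (fun t => ((e + `|t - c|) `^ (- beta))%:E).
  move=> mD; apply/measurable_EFinP; apply: (@measurable_funS _ _ _ _ setT) => //.
  by apply: continuous_measurable_fun; exact: continuous_singular_weight.
have w0 t : (0 <= ((e + `|t - c|) `^ (- beta))%:E)%E by rewrite lee_fin powR_ge0.
pose cl := c - M; pose cr := c + M.
have sub t : 0 <= t <= 2 * pi -> cl <= t < c \/ c <= t <= cr.
  move=> /andP[t0 t1]; rewrite /cl /cr /M.
  by have [tc|tc] := ltP t c; [left|right]; apply/andP; split=> //; lra.
have absl t : t <= c -> (e + `|t - c|) `^ (- beta) = ((e + c) + (-1) * t) `^ (g - 1).
  by move=> tc; rewrite ler0_norm ?subr_le0 // gE; congr (_ `^ _); ring.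
have absr t : c <= t -> (e + `|t - c|) `^ (- beta) = ((e - c) + 1 * t) `^ (g - 1).
  by move=> tc; rewrite ger0_norm ?subr_ge0 // gE; congr (_ `^ _); ring.
have el1 : 0 < e + c + -1 * cl by rewrite /cl; lra.
have el2 : 0 < e + c + -1 * c by lra.
have er1 : 0 < e - c + 1 * c by lra.
have er2 : 0 < e - c + 1 * cr by rewrite /cr; lra.
have n1 : -1 != 0 :> R by rewrite oppr_eq0 oner_eq0.
have g1 : g != 0 by rewrite gt_eqF.
pose D : set R := `[cl, c[%classic `|` `[c, cr]%classic.
have mD : measurable D by exact: measurableU.
have mwD := mw _ mD.
apply: (@le_trans _ _ (\int[mu]_(t in D) ((e + `|t - c|) `^ (- beta))%:E)%E).
  apply: ge0_subset_integral => //.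
rewrite ge0_integral_setU //; last first.
  apply/disj_setPS => t [] /=; rewrite !in_itv /= => /andP[_ tc] /andP[ct _].
  by move: (lt_le_trans tc ct); rewrite ltxx.
rewrite EFinD; apply: leeD.
- apply: (@le_trans _ _ (\int[mu]_(t in `[cl, c]) ((e + `|t - c|) `^ (- beta))%:E)%E).
    apply: ge0_subset_integral => //; first exact: mw.
    by move=> t /=; rewrite !in_itv /= => /andP[-> /ltW].
  have -> : (\int[mu]_(t in `[cl, c]) ((e + `|t - c|) `^ (- beta))%:E =
      \int[mu]_(t in `[cl, c]) ((e + c + (-1) * t) `^ (g - 1))%:E)%E.
    by apply: eq_integral => t; rewrite inE /= in_itv /= => /andP[_ tc]; rewrite absl.
  rewrite integral_affine_powR //.
  rewrite lee_fin.
  have -> : e + c + -1 * c = e by ring.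
  have -> : e + c + -1 * cl = e + M by rewrite /cl; ring.
  by rewrite mulN1r invrN mulrN -mulNr opprB.
- have -> : (\int[mu]_(t in `[c, cr]) ((e + `|t - c|) `^ (- beta))%:E =
      \int[mu]_(t in `[c, cr]) ((e - c + 1 * t) `^ (g - 1))%:E)%E.
    by apply: eq_integral => t; rewrite inE /= in_itv /= => /andP[tc _]; rewrite absr.
  rewrite integral_affine_powR //.
  rewrite lee_fin.
  have -> : e - c + 1 * cr = e + M by rewrite /cr; ring.
  have -> : e - c + 1 * c = e by ring.
  by rewrite mul1r.
Qed.

End PowerIntegrals.

(** * Distance from a point of the disc to the point 1 *)

Section DistanceToOne.
Context {R : realType}.
Local Open Scope complex_scope.
Implicit Types (r u v t : R).

Definition dist1 r u : R := modulus (1 - cpolar r u).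

Lemma dist1_ge0 r u : 0 <= dist1 r u.
Proof. exact: modulus_ge0. Qed.

Lemma dist1_sqr r u : dist1 r u ^+ 2 = (1 - r) ^+ 2 + 4 * r * sin (u / 2) ^+ 2.
Proof.
rewrite sqr_modulus /= sub0r sqrrN.
have -> : (1 - r * cos u) ^+ 2 + (r * sin u) ^+ 2 =
  1 - 2 * r * cos u + r ^+ 2 * (cos u ^+ 2 + sin u ^+ 2) by ring.
by rewrite cos2Dsin2 cos_half_sin -mulr_natr; ring.
Qed.

Lemma dist1_ge_sin r u : 0 < r < 1 -> `|sin (u / 2)| <= dist1 r u.
Proof.
move=> /andP[r0 r1]; rewrite -[leRHS]ger0_norm ?modulus_ge0 //.
rewrite -ler_sqr ?nnegrE // !real_normK ?num_real // dist1_sqr.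
have : sin (u / 2) ^+ 2 <= 1 by rewrite sin2cos2 gerBl sqr_ge0.
have := sqr_ge0 (sin (u / 2)); set s := sin _ ^+ 2 => s0 s1.
(* For r >= 1/4 the factor 4 r is at least 1; below that, (1 - r)^2 >= 1 - 4 r makes up for it. *)
have [r4|r4] := leP (1 / 4) r.
  by have := sqr_ge0 (1 - r); nra.
have : (1 - 4 * r) * s <= 1 - 4 * r by rewrite ler_piMr //; lra.
have := sqr_ge0 r; nra.
Qed.

Lemma dist1_ge_1r r u : 0 < r < 1 -> 1 - r <= dist1 r u.
Proof.
move=> /andP[r0 r1].
have q0 : 0 <= 1 - r by rewrite subr_ge0 ltW.
rewrite -ler_sqr ?nnegrE ?dist1_ge0 // dist1_sqr lerDl.
by rewrite mulr_ge0 ?sqr_ge0 // mulr_ge0 // ltW.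
Qed.

Lemma dist1_le r u : 0 < r < 1 -> dist1 r u <= 1 - r + `|u|.
Proof.
move=> /andP[r0 r1].
have q0 : 0 <= 1 - r by rewrite subr_ge0 ltW.
have q1 : 0 <= 1 - r + `|u| by rewrite addr_ge0.
rewrite -ler_sqr ?nnegrE ?dist1_ge0 // dist1_sqr.
have : `|sin (u / 2)| ^+ 2 <= (`|u| / 2) ^+ 2.
  rewrite lerXn2r ?nnegrE ?divr_ge0 // (le_trans (ler_norm_sin _)) //.
  by rewrite normrM [ `|2^-1|]ger0_norm ?invr_ge0.
rewrite real_normK ?num_real //.
set s := sin _ ^+ 2 => s1; have s0 : 0 <= s by exact: sqr_ge0.
have : r * s <= s by rewrite ler_piMl // ltW.
have : 0 <= (1 - r) * `|u| by rewrite mulr_ge0 // subr_ge0 ltW.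
nra.
Qed.

(** On [0, 1] the derivative of sine is at least 1/2; beyond 1, monotonicity gives sin v >= sin 1 >=
    1/2 >= v / 4, since v < 2. *)
Lemma sin_ge_quarter v : 0 <= v <= pi / 2 -> v / 4 <= sin v.
Proof.
move=> /andP[v0 v1]; have p2 := @pihalf_lt2 R.
have small (x : R) : 0 <= x <= 1 -> x / 2 <= sin x.
  move=> /andP[x0 x1]; have [c cx] := mean_value x (@is_derive_sin R).
  rewrite sin0 subr0 => ->; rewrite [leRHS]mulrC ler_wpM2l //.
  have := cos_quadratic c; have : c ^+ 2 <= `|x| ^+ 2.
    by rewrite -real_normK ?num_real // lerXn2r ?nnegrE.
  rewrite real_normK ?num_real // => c2; have : x ^+ 2 <= 1 by rewrite expr_le1.
  lra.
have [v2|v2] := leP v 1.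
  by apply: le_trans (small v _); rewrite ?v0 ?v2 //; lra.
have s1 := small 1; rewrite ler01 lexx in s1.
have : sin 1 <= sin v.
  rewrite leNgt ltr_sin ?in_itv /= -?leNgt ?(ltW v2) //; apply/andP; split; lra.
have := s1 isT; lra.
Qed.

(** Together with [dist1_le], this makes the distance comparable to 1 - r + |u|, whose powers have
    explicit antiderivatives. The factor 16 leaves room for both 1 - r and |u| / 8 being at most the
    distance. *)
Lemma dist1_ge r u : 0 < r < 1 -> `|u| <= pi -> (1 - r + `|u|) / 16 <= dist1 r u.
Proof.
move=> r01 up; have A := dist1_ge_1r u r01; have B := dist1_ge_sin u r01.
have : `|u| / 8 <= `|sin (u / 2)|.
  have -> : `|sin (u / 2)| = `|sin (`|u| / 2)|.
    have [u0|u0] := leP 0 u; first by rewrite (ger0_norm u0).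
    by rewrite (ltr0_norm u0) mulNr sinN normrN.
  have := @sin_ge_quarter (`|u| / 2); rewrite divr_ge0 // ler_pM2r ?invr_gt0 // up.
  by move=> /(_ isT); have := ler_norm (sin (`|u| / 2)); lra.
case/andP: r01 => r0 r1; lra.
Qed.

Lemma dist1_periodic r u : dist1 r (u - 2 * pi) = dist1 r u.
Proof.
rewrite /dist1 /cpolar; have E : u = (u - 2 * pi) + pi *+ 2.
  by rewrite -mulr_natr; ring.
by rewrite [in RHS]E sinD2pi cosD2pi.
Qed.

Lemma dist1_gt0 r u : 0 < r < 1 -> 0 < dist1 r u.
Proof.
move=> r01; rewrite (lt_le_trans _ (dist1_ge_1r u r01)) // subr_gt0.
by case/andP: r01.
Qed.

Lemma dist1_le2 r u : 0 < r < 1 -> dist1 r u <= 2.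
Proof.
move=> /andP[r0 r1]; rewrite (le_trans (ler_modulusB _ _)) //.
by rewrite modulus1 modulus_cpolar ?ltW //; lra.
Qed.

Lemma exists_principal_angle u :
  exists2 v, `|v| <= pi & cos v = cos u /\ sin v = sin u.
Proof.
have c1 : -1 <= cos u <= 1 by rewrite cos_geN1 cos_le1.
have a0 := acos_ge0 c1; have api := acos_lepi c1.
have ck : cos (acos (cos u)) = cos u by rewrite acosK // in_itv.
have sk : sin (acos (cos u)) = `|sin u|.
  by rewrite sin_acos // -sin2cos2 sqrtr_sqr.
have [s0|s0] := leP 0 (sin u).
  by exists (acos (cos u)); rewrite ?ger0_norm // sk ger0_norm.
exists (- acos (cos u)); first by rewrite normrN ger0_norm.
by rewrite cosN sinN sk ltr0_norm // opprK.
Qed.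

Lemma dist1_shift r t u v : cos v = cos u -> sin v = sin u ->
  dist1 r (t - v) = dist1 r (t - u).
Proof. by move=> cuv suv; rewrite /dist1 /cpolar !cosB !sinB cuv suv. Qed.

Lemma measurable_dist1_powR r u (beta : R) :
  measurable_fun setT (fun t => dist1 r (t - u) `^ beta).
Proof.
apply: (@measurableT_comp _ _ _ _ _ _ (@powR R ^~ beta)) => //.
apply: continuous_measurable_fun => t.
apply: (@continuous_comp _ R[i]^o _ (fun t => 1 - cpolar r (t - u)) (@modulus R)).
  have pc : {for t, continuous (fun t => cpolar r (t - u) : R[i]^o)}.
    apply: (@continuous_comp _ _ R[i]^o (fun t => t - u) (cpolar r)).
      by apply: cvgB; [exact: cvg_id|exact: cvg_cst].
    exact: cpolar_continuous.
  apply/cvg_modulusP => d d0; have /cvg_modulusP/(_ d d0) := pc.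
  apply: filterS => s; rewrite -modulusN; congr (modulus _ < _).
  by rewrite /=; ring.
exact: continuous_modulus.
Qed.

(** After u is reduced to v in [-pi, pi], the difference t - v ranges over [-pi, 3 pi]; either it or
    t - v - 2 pi lies in [-pi, pi], where [dist1_ge] applies. Hence two weights, centred at v and v
    + 2 pi, and the bound 3 pi on the centres. *)
Lemma dist1_mean (beta : R) : 0 < beta < 1 ->
  exists K : R, forall u r, 0 < r < 1 ->
  (\int[lebesgue_measure]_(t in `[0%R, (2 * pi)%R]) (dist1 r (t - u) `^ (- beta))%:E
    <= K%:E)%E.
Proof.
move=> b01; have [K [K0 hK]] := integral_singular_weight (3 * pi) b01.
pose k := 16 `^ beta : R.
exists (k * K + k * K) => u r r01.
have [v vpi [cuv suv]] := exists_principal_angle u.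
have e01 : 0 < 1 - r < 1 by case/andP: r01 => *; apply/andP; split; lra.
have e0 : 0 < 1 - r by case/andP: e01.
have pi0 := @pi_gt0 R.
have v3 : `|v| <= 3 * pi by lra.
have v4 : `|v + 2 * pi| <= 3 * pi.
  by move: vpi; rewrite !ler_norml => /andP[? ?]; apply/andP; split; lra.
apply: (@le_trans _ _ (k%:E * \int[lebesgue_measure]_(t in `[0%R, (2 * pi)%R])
    ((1 - r + `|t - v|) `^ (- beta))%:E + k%:E *
    \int[lebesgue_measure]_(t in `[0%R, (2 * pi)%R])
    ((1 - r + `|t - (v + 2 * pi)|) `^ (- beta))%:E)%E); last first.
  by rewrite EFinD !EFinM; apply: leeD; apply: lee_wpmul2l;
    rewrite ?lee_fin ?powR_ge0 //; apply: hK.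
apply: ler_integral_lincomb; rewrite ?powR_ge0 //; try by move=> t; exact: powR_ge0.
- by apply: continuous_measurable_fun; exact: continuous_singular_weight.
- by apply: continuous_measurable_fun; exact: continuous_singular_weight.
- exact: measurable_dist1_powR.
move=> t /=; rewrite in_itv /= => /andP[t0 t1].
have key w : `|w| <= pi -> dist1 r w `^ (- beta) <= k * (1 - r + `|w|) `^ (- beta).
  move=> wpi; have d0 := dist1_gt0 w r01.
  have q0 : 0 < 1 - r + `|w| by rewrite ltr_pwDl.
  set q := 1 - r + _ in q0 *; have k0 : 0 < k by rewrite powR_gt0.
  have q16 : 0 < q / 16 by rewrite divr_gt0.
  have -> : k * q `^ (- beta) = ((q / 16) `^ beta)^-1.
    have -> : q `^ (- beta) = (k * (q / 16) `^ beta)^-1.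
      by rewrite powRN -powRM ?(ltW q16) // mulrC divfK.
    by rewrite invfM mulrA divff ?gt_eqF // mul1r.
  rewrite powRN lef_pV2 ?posrE ?powR_gt0 //.
  apply: ge0_ler_powR; rewrite ?nnegrE ?(ltW q16) ?(ltW d0) //.
    by case/andP: b01 => /ltW.
  exact: dist1_ge.
rewrite -(dist1_shift r t cuv suv).
move: vpi; rewrite ler_norml => /andP[v1 v2].
have [tv|tv] := leP (t - v) pi.
  rewrite (le_trans (key _ _)) ?lerDl ?mulr_ge0 ?powR_ge0 //.
  by rewrite ler_norml; apply/andP; split; lra.
rewrite -dist1_periodic -addrA -opprD (le_trans (key _ _)) ?lerDr ?mulr_ge0 ?powR_ge0 //.
by rewrite ler_norml; apply/andP; split; lra.
Qed.

End DistanceToOne.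

(** * Singular kernels and their rotations *)

Section SingularKernels.
Context {R : realType}.
Local Open Scope complex_scope.
Local Notation C := (R[i]).
Local Notation cfun := (C -> C^o).
Implicit Types (S : set R) (q : \bar R) (H : cfun) (r s t u : R) (w z : C).

(* [H] is meant to be singular at the boundary point [0] of the right half
   plane, so that [z |-> H (1 - z)] is singular at the point [1] of the circle. *)
Definition singular_kernel S q H : Prop :=
  [/\ forall z : C^o, 0 < complex.Re z -> derivable (H : C^o -> C^o) z 1,
    forall s, S s -> exists beta K, 0 < beta < 1 /\
      forall w, 0 < complex.Re w -> modulus w <= 2 ->
        modulus (H w) `^ s <= K * modulus w `^ (- beta)
  & match q with
    | q%:E => forall w, 0 < complex.Re w -> modulus w <= 1 ->
        modulus w `^ (-1) <= modulus (H w) `^ q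
    | +oo%E => forall M, exists2 e, 0 < e < 1 & M < modulus (H e%:C)
    | -oo%E => True
    end].

Definition rotated H u : cfun :=
  fun z => if modulus z < 1 then H (1 - z * cpolar 1 (- u)) else 0.

Lemma cpolar_rotate r t u : cpolar r t * cpolar 1 (- u) = cpolar r (t - u).
Proof.
rewrite /cpolar !mul1r; simpc.
by rewrite cosB sinB cosN sinN; apply/eqP; rewrite eq_complex /=;
  apply/andP; split; apply/eqP; ring.
Qed.

Lemma Re_rotated_gt0 z u : modulus z < 1 ->
  0 < complex.Re (1 - z * cpolar 1 (- u)).
Proof.
move=> z1; rewrite raddfB /= subr_gt0; apply: le_lt_trans z1.
rewrite (le_trans (ler_norm _)) // (le_trans (ler_Re_modulus _)) //.
by rewrite modulusM modulus_cpolar ?mulr1.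
Qed.

Lemma rotatedE H u r t : 0 < r < 1 ->
  rotated H u (cpolar r t) = H (1 - cpolar r (t - u)).
Proof.
move=> r01; rewrite /rotated modulus_cpolar ?cpolar_rotate; case/andP: r01 => [r0 r1].
  by rewrite r1.
exact: ltW.
Qed.

Lemma Re_dist1_gt0 r u : 0 < r < 1 -> 0 < complex.Re (1 - cpolar r u).
Proof.
move=> r01; have r1 : modulus (cpolar r u) < 1.
  by rewrite modulus_cpolar; case/andP: r01 => // /ltW.
have := Re_rotated_gt0 0 r1.
by rewrite cpolar_rotate subr0.
Qed.

Lemma holomorphic_rotated S q H u : singular_kernel S q H ->
  holomorphic_disc (rotated H u).
Proof.
case=> dH _ _; split=> [z z1|z z1]; last first.
  by rewrite /rotated; case: ifP => // /unit_discE.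
pose A (z : C^o) : C^o := 1 - z * cpolar 1 (- u).
have dA : derivable A z 1.
  apply: (@derivable_quadratic _ _ _ (- cpolar 1 (- u)) 0 1) => // h _.
  rewrite mul0r /A; have -> : 1 - (z + h) * cpolar 1 (- u) - (1 - z * cpolar 1 (- u))
    - h * - cpolar 1 (- u) = 0 by ring.
  by rewrite modulus0.
have dHA : derivable ((H : C^o -> C^o) \o A) z 1.
  apply/derivable1_diffP; apply: (@differentiable_comp _ C^o C^o C^o).
    exact/derivable1_diffP.
  by apply/derivable1_diffP; apply: dH; apply: Re_rotated_gt0; apply/unit_discE.
apply: (@near_eq_derivable _ C^o C^o _ _ _ _ _ dHA).
apply: filterS (unit_disc_nbhs z1) => w /unit_discE w1.
by rewrite /rotated w1.
Qed.

Lemma rotated_mean S q H s : singular_kernel S q H -> S s ->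
  exists2 M, 0 <= M & forall u, (radial_mean s 0 (2 * pi) (rotated H u) <= M%:E)%E.
Proof.
move=> kH Ss; case: (kH) => _ /(_ s Ss)[beta [K [b01 HK]]] _.
have [L hL] := dist1_mean b01.
(* The second term matches the two-term form of [ler_integral_lincomb]; the outer absolute value
   makes the bound nonnegative. *)
exists (`| `|K| * L + 0 * L |); first exact: normr_ge0.
move=> u; have hol := holomorphic_rotated u kH.
apply/ereal_supP => x [r /=]; rewrite in_itv /= => r01 <-.
apply: (@le_trans _ _ (`|K| * L + 0 * L)%:E); last by rewrite lee_fin ler_norm.
apply: (@le_trans _ _ (`|K|%:E * \int[lebesgue_measure]_(t in `[0%R, (2 * pi)%R])
    (dist1 r (t - u) `^ (- beta))%:E + 0%:E * \int[lebesgue_measure]_(t in `[0%R, (2 * pi)%R])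
    (dist1 r (t - u) `^ (- beta))%:E)%E); last first.
  by rewrite EFinD !EFinM; apply: leeD; apply: lee_wpmul2l;
    rewrite ?lee_fin //; exact: hL.
apply: ler_integral_lincomb => //; try by move=> t; exact: powR_ge0.
- exact: measurable_dist1_powR.
- exact: measurable_dist1_powR.
- exact: circle_measurable.
move=> t _; rewrite rotatedE // mul0r addr0.
rewrite (le_trans (HK _ (Re_dist1_gt0 _ r01) (dist1_le2 _ r01))) //.
by rewrite ler_wpM2r ?powR_ge0 // ler_norm.
Qed.

Lemma rotated_hardy S q H u s : singular_kernel S q H -> S s ->
  hardy s (rotated H u).
Proof.
move=> kH Ss; split; first exact: holomorphic_rotated kH.
have [M _ HM] := rotated_mean kH Ss.
exact: le_lt_trans (HM u) (ltry _).
Qed.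

(** The growth bound |K| |w|^(-beta) for a single power of H decreases in |w|, so away from 0 it
    becomes a uniform bound on H after taking an s-th root. *)
Lemma kernel_bounded_away S q H s d : singular_kernel S q H -> S s -> 0 < s -> 0 < d ->
  exists M, forall w, 0 < complex.Re w -> d <= modulus w <= 2 -> modulus (H w) <= M.
Proof.
move=> [_ /(_ s)+ _] Ss s0 d0 => /(_ Ss)[beta [K [/andP[b0 b1] HK]]].
exists ((`|K| * d `^ (- beta)) `^ s^-1) => w w0 /andP[dw w2].
have -> : modulus (H w) = (modulus (H w) `^ s) `^ s^-1.
  by rewrite -powRrM divff ?gt_eqF // powRr1 // modulus_ge0.
apply: ge0_ler_powR; rewrite ?nnegrE ?powR_ge0 ?mulr_ge0 ?powR_ge0 ?invr_ge0 ?(ltW s0) //.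
rewrite (le_trans (HK _ w0 w2)) // (@le_trans _ _ (`|K| * modulus w `^ (- beta))) //.
  by rewrite ler_wpM2r ?powR_ge0 // ler_norm.
rewrite ler_wpM2l // !powRN lef_pV2 ?posrE ?powR_gt0 //; last exact: lt_le_trans dw.
by apply: ge0_ler_powR; rewrite ?nnegrE ?modulus_ge0 // ltW.
Qed.

Lemma rotated_local_away S q H s u a b d : singular_kernel S q H -> S s -> 0 < s ->
  (0 < q)%E -> 0 < d -> a <= b ->
  (forall t, a <= t <= b -> d <= `|t - u| <= pi) ->
  local_hardy q a b (rotated H u).
Proof.
move=> kH Ss s0 q0 d0 ab far.
have d16 : 0 < d / 16 by rewrite divr_gt0.
have [M HM] := kernel_bounded_away kH Ss s0 d16.
apply: (@local_hardy_bounded _ _ _ _ _ M) => //; first exact: holomorphic_rotated kH.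
move=> r t r01 tab; rewrite rotatedE //; apply: HM; first exact: Re_dist1_gt0.
rewrite -/(dist1 _ _) dist1_le2 // andbT.
have /andP[dt tpi] := far t tab.
apply: le_trans (dist1_ge r01 tpi); case/andP: r01 => r0 r1; lra.
Qed.

(** For finite q, the integral over the arc of radius 1 - eps dominates that of 1 / (eps + t - u),
    which is ln ((eps + e) / eps) and unbounded as eps tends to 0. For q = oo, the values on the
    radius at angle u are unbounded. *)
Lemma rotated_not_local S q H u d : singular_kernel S q H -> (0 < q)%E -> 0 < d ->
  ~ local_hardy q u (u + d) (rotated H u).
Proof.
(* With e <= 1/2 and eps <= e, the distance to the singularity stays at most 1, the range of the
   lower bound on the kernel. *)
move=> kH q0 d0 hloc; pose e := Num.min d (1 / 2).
have e0 : 0 < e by rewrite lt_min d0 /=; lra.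
have {hloc} : local_hardy q u (u + e) (rotated H u).
  by apply: (@local_hardy_subset _ _ u (u + d)) hloc => //; rewrite lerD2l ge_min lexx.
have e2 : e <= 1 / 2 by rewrite ge_min lexx orbT.
case: q q0 kH => [q| |] //; last first.
  move=> _ [_ _ low] [_ /radial_sup_ltyP[M HM]].
  have [eps eps01 HMe] := low M; case/andP: eps01 => eps0 eps1.
  have r01 : 0 < 1 - eps < 1 by apply/andP; split; lra.
  have := HM (1 - eps) u r01; rewrite lexx lerDl (ltW e0) => /(_ isT).
  rewrite rotatedE // subrr /cpolar cos0 sin0 mulr1 mulr0.
  have -> : 1 - (1 - eps)%:C = eps%:C by rewrite rmorphB /=; ring.
  by move=> /(lt_le_trans HMe); rewrite ltxx.
move=> q0 kH [_ /radial_mean_ltyP[M HM]].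
have hol := holomorphic_rotated u kH; case: kH => _ _ low.
(* Chosen so that ln (e / eps) = |M| + 1 exceeds [M]. *)
pose eps := e * expR (- (`|M| + 1)).
have eps0 : 0 < eps by rewrite mulr_gt0 ?expR_gt0.
have epse : eps <= e.
  by rewrite ler_piMr ?(ltW e0) // -expR0 ler_expR oppr_le0 addr_ge0.
have r01 : 0 < 1 - eps < 1 by apply/andP; split; lra.
have := HM _ r01; apply/negP; rewrite -ltNge.
apply: (@lt_le_trans _ _ (\int[lebesgue_measure]_(t in `[u, (u + e)%R])
    ((eps - u + 1 * t) `^ (-1))%:E)%E).
  rewrite integral_affine_inv ?ltrDl ?subrK // lte_fin.
  have -> : eps - u + (u + e) = eps + e by ring.
  have : ln e <= ln (eps + e) by rewrite ler_ln ?posrE ?addr_gt0 // lerDr ltW.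
  rewrite [ln eps]lnM ?posrE ?expR_gt0 // expRK.
  by have := ler_norm M; lra.
apply: ge0_le_integral => //.
- by move=> t _; rewrite lee_fin powR_ge0.
- apply/measurable_EFinP; apply: (@measurable_funS _ _ _ _ setT) => //.
  apply: (@measurableT_comp _ _ _ _ _ _ (@powR R ^~ (-1))) => //.
  by apply: measurable_funD => //; exact: measurable_funM.
- apply/measurable_EFinP; apply: (@measurable_funS _ _ _ _ setT) => //.
  exact: circle_measurable.
move=> t /=; rewrite in_itv /= => /andP[ut tu]; rewrite lee_fin rotatedE //.
have tu0 : 0 <= t - u by rewrite subr_ge0.
have d1 : dist1 (1 - eps) (t - u) <= eps - u + 1 * t.
  rewrite (le_trans (dist1_le _ r01)) // ger0_norm //; lra.
have d2 := dist1_gt0 (t - u) r01.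
apply: le_trans (low _ (Re_dist1_gt0 _ r01) _); last first.
  by rewrite -/(dist1 _ _); apply: le_trans d1 _; lra.
rewrite -/(dist1 _ _) !powR_inv1 ?(ltW d2) //; last by rewrite (le_trans (ltW d2)).
by rewrite lef_pV2 // posrE // (lt_le_trans d2).
Qed.

End SingularKernels.

(** * The power kernel and the logarithmic kernel *)

Section KernelExistence.
Context {R : realType}.
Local Open Scope complex_scope.
Implicit Types (w : R[i]) (p q : \bar R).

(** The kernel is w^(-1/p), of modulus |w|^(-1/p): its s-th power has exponent - s / p > -1, its
    q-th power exponent - q / p <= -1. *)
Lemma singular_power_kernel (S : set R) (p : R) q : 0 < p -> (p%:E <= q)%E ->
  (forall s, S s -> 0 < s < p) ->
  singular_kernel S q (fun w => cexp ((- p^-1)%:C * clog w)).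
Proof.
move=> p0 pq Sp.
have p1 : 0 < p^-1 by rewrite invr_gt0.
have mE w : 0 < complex.Re w ->
    modulus (cexp ((- p^-1)%:C * clog w)) = modulus w `^ (- p^-1).
  move=> w0; have mw := Re_modulus_gt0 w0.
  rewrite modulus_cexp /powR gt_eqF //; congr expR.
  by rewrite /clog; simpc.
split.
- move=> z z0; apply/derivable1_diffP.
  apply: (@differentiable_comp _ R[i]^o R[i]^o R[i]^o
    (fun w => (- p^-1)%:C * clog w) (@cexp R)).
    apply/derivable1_diffP.
    exact: (@derivableZ _ R[i]^o R[i]^o (@clog R) (- p^-1)%:C z 1 (derivable_clog z0)).
  by apply/derivable1_diffP; exact: derivable_cexp.
- move=> s /Sp/andP[s0 sp]; exists (s / p), 1; split.
    by rewrite divr_gt0 // ltr_pdivrMr // mul1r.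
  move=> w w0 _; rewrite mE // -powRrM mul1r.
  by have -> : - p^-1 * s = - (s / p) by rewrite mulNr mulrC.
- case: q pq => [q| |] //; rewrite ?lee_fin => pq.
    move=> w w0 w1; rewrite mE // -powRrM; apply: ger_powR.
      by rewrite Re_modulus_gt0.
    by rewrite mulNr lerN2 mulrC ler_pdivlMr // mul1r.
  (* At [e] the kernel has modulus |M| + 2; the base exceeds 1, hence e < 1. *)
  move=> M; pose e := (`|M| + 2) `^ (- p); have M2 : 1 < `|M| + 2.
    by have := normr_ge0 M; lra.
  have M0 : 0 < `|M| + 2 by apply: lt_trans M2.
  have e0 : 0 < e by rewrite powR_gt0.
  exists e.
    rewrite e0 /= /e powRN invf_lt1 ?powR_gt0 //.
    by rewrite -[ltLHS](powRr0 (`|M| + 2)) /powR !gt_eqF // ltr_expR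
      mul0r mulr_gt0 // ln_gt0.
  rewrite mE //= modulus_real gtr0_norm // /e -powRrM mulrNN divff ?gt_eqF //.
  by rewrite powRr1 ?(ltW M0) //; have := ler_norm M; lra.
Qed.

(** The inequality ln y <= y at y = x^(-k) bounds - ln x. The second summand takes care of positive
    ln x: it is at most 2, and 2^k x^(-k) >= 1 because x <= 2. *)
Lemma ler_ln_powR (x k : R) : 0 < x <= 2 -> 0 < k ->
  `|ln x| <= (k^-1 + 2 * 2 `^ k) * x `^ (- k).
Proof.
move=> /andP[x0 x2] k0.
have lny y : 0 < y -> ln y <= y :> R.
  move=> y0; have := @le_ln1Dx R (y - 1).
  have -> : 1 + (y - 1) = y by ring.
  by move=> ly; apply: le_trans (ly _) _; lra.
have xk : 0 < x `^ (- k) by rewrite powR_gt0.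
have A : - ln x <= k^-1 * x `^ (- k).
  rewrite mulrC ler_pdivlMr // mulrC mulrN -mulNr -ln_powR; exact: lny.
have B : 1 <= 2 `^ k * x `^ (- k).
  rewrite powRN ler_pdivlMr ?powR_gt0 // mul1r.
  by apply: ge0_ler_powR; rewrite ?nnegrE // ltW.
have D : ln x <= 2 by rewrite (le_trans (lny _ x0)).
have E : 0 <= k^-1 * x `^ (- k) by rewrite mulr_ge0 ?invr_ge0 // ltW.
by rewrite ler_norml mulrDl; apply/andP; split; lra.
Qed.

Lemma singular_log_kernel (S : set R) : (forall s, S s -> 0 < s) ->
  singular_kernel S +oo%E (@clog R).
Proof.
move=> S0; split; first exact: derivable_clog.
(* With this k, the s-th power of |w|^(-k) is |w|^(-1/2). The last summand of [K] absorbs the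
   argument, which is bounded by pi / 2 < 2. *)
- move=> s /S0 s0; pose k := (2 * s)^-1; have k0 : 0 < k by rewrite invr_gt0 mulr_gt0.
  pose K := k^-1 + 2 * 2 `^ k + 2 * 2 `^ k.
  have K0 : 0 <= K.
    have := powR_ge0 2 k; have : 0 < k^-1 by rewrite invr_gt0.
    rewrite /K; lra.
  exists (1 / 2), (K `^ s); split; first by apply/andP; split; lra.
  move=> w w0 w2; have mw := Re_modulus_gt0 w0.
  have -> : modulus w `^ (- (1 / 2)) = (modulus w `^ (- k)) `^ s.
    by rewrite -powRrM; congr (_ `^ _); rewrite /k; field; rewrite gt_eqF.
  rewrite -powRM ?powR_ge0 //; apply: ge0_ler_powR;
    rewrite ?nnegrE ?modulus_ge0 ?mulr_ge0 ?powR_ge0 ?(ltW s0) //.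
  rewrite (le_trans (modulus_le_ReIm _)) //= mulrDl lerD //.
    by apply: ler_ln_powR => //; rewrite mw.
  apply: (@le_trans _ _ 2).
    have p2 := @pihalf_lt2 R; have := atan_gtNpi2 (complex.Im w / complex.Re w).
    have := atan_ltpi2 (complex.Im w / complex.Re w) => *.
    by rewrite ler_norml; apply/andP; split; lra.
  rewrite -mulrA ler_peMr // powRN ler_pdivlMr ?powR_gt0 // mul1r.
  by apply: ge0_ler_powR; rewrite ?nnegrE // ltW.
- move=> M; exists (expR (- (`|M| + 1))).
    by rewrite expR_gt0 /= -expR0 ltr_expR oppr_lt0 ltr_wpDl.
  apply: lt_le_trans (ler_Re_modulus _).
  rewrite /= modulus_real (gtr0_norm (expR_gt0 _)) expRK normrN.
  rewrite ger0_norm ?addr_ge0 //; have := ler_norm M; lra.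
Qed.

End KernelExistence.

(** * Coding holomorphic functions by real numbers *)

Section TernaryExpansion.
Context {R : realType}.
Implicit Types (b c : nat -> bool) (m n : nat).

(** Base 3 with digits 0 and 1: all that follows a digit adds at most half of its unit, so that,
    unlike in base 2, distinct sequences have distinct sums. *)
Definition ternary_sum b n : R := \sum_(i < n) (b i)%:R / 3 ^+ i.+1.

Definition ternary b : R := sup (range (ternary_sum b)).

Lemma ternary_sumS b n : ternary_sum b n.+1 = ternary_sum b n + (b n)%:R / 3 ^+ n.+1.
Proof. by rewrite /ternary_sum big_ord_recr. Qed.

Lemma ternary_sum_tail b m n :
  ternary_sum b m <= ternary_sum b (m + n) <=
  ternary_sum b m + ((3 ^+ m)^-1 - (3 ^+ (m + n))^-1) / 2.
Proof.
elim: n => [|n /andP[IH1 IH2]]; first by rewrite addn0 subrr mul0r addr0 lexx.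
rewrite addnS ternary_sumS.
have p3 : 0 < (3 ^+ (m + n).+1 : R)^-1 by rewrite invr_gt0 exprn_gt0.
have E3 : (3 ^+ (m + n) : R)^-1 = 3 * (3 ^+ (m + n).+1)^-1.
  by rewrite exprS invfM mulrA divff ?mul1r.
move: IH1 IH2; rewrite E3; set q := (3 ^+ _.+1)^-1 in p3 *.
set s := ternary_sum b (m + n) => IH1 IH2.
by case: (b (m + n)) => /=; rewrite ?mul1r ?mul0r; apply/andP; split; lra.
Qed.

Lemma ternary_sum_le b m n : ternary_sum b n <= ternary_sum b m + (3 ^+ m)^-1 / 2.
Proof.
have p3 k : 0 < (3 ^+ k : R)^-1 by rewrite invr_gt0 exprn_gt0.
have := p3 m; have [mn|/ltnW nm] := leqP m n.
  have /andP[_] := ternary_sum_tail b m (n - m); rewrite subnKC //.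
  by have := p3 n; lra.
by have /andP[+ _] := ternary_sum_tail b n (m - n); rewrite subnKC //; lra.
Qed.

Lemma ternary_bounds b m :
  ternary_sum b m <= ternary b <= ternary_sum b m + (3 ^+ m)^-1 / 2.
Proof.
have ub : ubound (range (ternary_sum b)) (ternary_sum b m + (3 ^+ m)^-1 / 2).
  by move=> _ [n _ <-]; exact: ternary_sum_le.
apply/andP; split; last first.
  by apply: ge_sup => //; exists (ternary_sum b 0), 0%N.
by apply: ub_le_sup; [exists (ternary_sum b m + (3 ^+ m)^-1 / 2)|exists m].
Qed.

Lemma ternary_itv b : 0 <= ternary b <= 1 / 2.
Proof.
by have := ternary_bounds b 0; rewrite /ternary_sum big_ord0 expr0 invr1 add0r.
Qed.

Lemma ternary_inj : injective ternary.
Proof.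
move=> b c bc; apply: contrapT => nbc.
have ex : exists n, b n != c n.
  apply: contrapT => nex; apply: nbc; apply/funext => n.
  by apply/eqP/negPn/negP => bn; apply: nex; exists n.
case: (ex_minnP ex) => m bm mmin.
have eq_lt i : (i < m)%N -> b i = c i.
  by move=> im; apply/eqP/negPn/negP => /mmin; rewrite leqNgt im.
wlog [bT cF] : b c bc bm {ex nbc mmin} eq_lt / b m = true /\ c m = false.
  move=> W; case bE : (b m); case cE : (c m); move: (bm); rewrite bE cE // => _.
    exact: (W b c).
  by apply: (W c b) => // [|i im]; [rewrite eq_sym|rewrite eq_lt].
have S_eq : ternary_sum b m = ternary_sum c m.
  by apply: eq_bigr => i _; rewrite eq_lt.
have /andP[+ _] := ternary_bounds b m.+1.
have /andP[_] := ternary_bounds c m.+1.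
rewrite bc !ternary_sumS bT cF S_eq mul0r mul1r.
have : 0 < (3 ^+ m.+1 : R)^-1 by rewrite invr_gt0 exprn_gt0.
lra.
Qed.

End TernaryExpansion.

Section CodingHolomorphicFunctions.
Context {R : realType}.
Local Open Scope complex_scope.
Local Notation cfun := (R[i] -> R[i]^o).
Implicit Types (f g : cfun) (n : nat).

Lemma exists_rat_near (x d : R) : 0 < d -> exists r : rat, `|x - ratr r| < d.
Proof.
move=> d0; have [|r] := @rat_in_itvoo R (x - d) (x + d); first lra.
rewrite in_itv /= => /andP[r1 r2]; exists r.
by rewrite ltr_norml; apply/andP; split; lra.
Qed.

Lemma eq_rat_cuts (x y : R) : (forall r : rat, (x < ratr r) = (y < ratr r)) -> x = y.
Proof.
move=> H; apply/eqP; rewrite eq_le !leNgt; apply/andP; split; apply/negP => /rat_in_itvoo[r];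
  rewrite in_itv /= => /andP[h1 h2]; move: (H r).
  by rewrite h1 ltNge (ltW h2).
by rewrite h1 ltNge (ltW h2).
Qed.

(** Inside the disc continuity suffices; outside, both functions vanish by convention. *)
Lemma holomorphic_eq_rat f g : holomorphic_disc f -> holomorphic_disc g ->
  (forall x y : rat, f (ratr x +i* ratr y) = g (ratr x +i* ratr y)) -> f = g.
Proof.
move=> hf hg fg; apply/funext => z.
have [z1|z1] := pselect (unit_disc z); last by rewrite hf.2 // hg.2.
apply: contrapT => nfg.
have e0 : 0 < modulus (f z - g z) / 2.
  rewrite divr_gt0 // lt_neqAle modulus_ge0 andbT eq_sym modulus_eq0 subr_eq0.
  exact/eqP.
have near h : holomorphic_disc h -> exists2 d, 0 < d &
    forall w, modulus (z - w) < d -> modulus (h z - h w) < modulus (f z - g z) / 2.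
  move=> hh; have /cvg_modulusP/(_ _ e0) := holomorphic_continuous hh z1.
  by move=> /near_modulusP.
have [d1 d10 fd] := near f hf; have [d2 d20 gd] := near g hg.
pose d := Num.min d1 d2; have d0 : 0 < d / 2 by rewrite divr_gt0 // lt_min d10.
have [x xd] := exists_rat_near (complex.Re z) d0.
have [y yd] := exists_rat_near (complex.Im z) d0.
have wd : modulus (z - (ratr x +i* ratr y)) < d.
  apply: le_lt_trans (modulus_le_ReIm _) _.
  by rewrite !raddfB /= [d]splitr ltrD.
move: wd; rewrite lt_min => /andP[/fd f1 /gd g1].
have := ler_modulusB (f z - f (ratr x +i* ratr y)) (g z - g (ratr x +i* ratr y)).
rewrite fg.
have -> : f z - g (ratr x +i* ratr y) - (g z - g (ratr x +i* ratr y)) = f z - g z by ring.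
by rewrite fg in f1; lra.
Qed.

(** The bits record n in one-hot form, together with the Dedekind cuts of the real and imaginary
    parts of f at every point with rational coordinates; [unpickle] enumerates these questions. *)
Definition code f n (k : nat) : bool :=
  match unpickle k : option (nat + rat * rat * bool * rat) with
  | Some (inl m) => m == n
  | Some (inr (x, y, c, r)) =>
      (if c then @complex.Re R else @complex.Im R) (f (ratr x +i* ratr y)) < ratr r
  | None => false
  end.

Lemma code_inj f g m n : holomorphic_disc f -> holomorphic_disc g ->
  code f m = code g n -> f = g /\ m = n.
Proof.
move=> hf hg E; split; last first.
  have := congr1 (fun h => h (pickle (inl m : nat + rat * rat * bool * rat))) E.
  by rewrite /code pickleK eqxx => /esym/eqP.
apply: holomorphic_eq_rat => // x y.
have cE c r : (if c then @complex.Re R else @complex.Im R) (f (ratr x +i* ratr y)) < ratr r =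
    ((if c then @complex.Re R else @complex.Im R) (g (ratr x +i* ratr y)) < ratr r).
  have := congr1 (fun h => h (pickle (inr (x, y, c, r) : nat + rat * rat * bool * rat))) E.
  by rewrite /code pickleK.
apply/eqP; rewrite eq_complex; apply/andP; split; apply/eqP; apply: eq_rat_cuts => r.
  exact: (cE true r).
exact: (cE false r).
Qed.

End CodingHolomorphicFunctions.

(** * The dense subspace *)

Section DenseSubspace.
Context {R : realType}.
Local Open Scope complex_scope.
Local Notation C := (R[i]).
Local Notation cfun := (C -> C^o).
Let U : lmodType C := cfun.
Implicit Types (S : set R) (q : \bar R) (H f g : cfun) (s a b u : R) (n : nat).

(** These germs serve as the sets [Z i] of [exists_complement_through]. Letting the length d vary
    allows the arc to avoid the singularity of any given rotation with another angle. *)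
Definition local_hardy_germ q u : set U :=
  [set f | exists2 d, 0 < d & local_hardy q u (u + d) f].

Lemma local_hardy_germ_subspace q u : (0 < q)%E -> subspace (local_hardy_germ q u).
Proof.
move=> q0; split; first by exists 1 => //; exact: (local_hardy_subspace _ _ q0).1.
move=> c f g [d d0 fd] [d' d'0 gd]; pose m := Num.min d d'.
exists m; first by rewrite lt_min d0.
apply: (local_hardy_subspace _ _ q0).2.
  by apply: local_hardy_subset fd => //; rewrite lerD2l ge_min lexx.
by apply: local_hardy_subset gd => //; rewrite lerD2l ge_min lexx orbT.
Qed.

Lemma bigcap_hardy_subspace S : (forall s, S s -> 0 < s) ->
  subspace (\bigcap_(s in S) hardy s : set U).
Proof.
move=> S0; split.
  by move=> s Ss; have /(local_hardy_subspace 0 (2 * pi))[+ _] : (0 < s%:E)%E by exact: S0.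
move=> c f g fS gS s Ss.
have /(local_hardy_subspace 0 (2 * pi))[_ sub] : (0 < s%:E)%E by exact: S0.
by apply: sub; [exact: fS|exact: gS].
Qed.

Lemma radial_mean_scale s (c : C) f (M : R) : 0 < s -> holomorphic_disc f ->
  (radial_mean s 0 (2 * pi) f <= M%:E)%E ->
  (radial_mean s 0 (2 * pi) (c *: (f : U))%R <= (modulus c `^ s * M)%:E)%E.
Proof.
move=> s0 hf fM; apply/ereal_supP => x [r /=]; rewrite in_itv /= => r01 <-.
have -> : (\int[lebesgue_measure]_(t in `[0%R, (2 * pi)%R])
     (modulus ((c *: (f : U)) (cpolar r t)) `^ s)%:E =
   (modulus c `^ s)%:E * \int[lebesgue_measure]_(t in `[0%R, (2 * pi)%R])
     (modulus (f (cpolar r t)) `^ s)%:E)%E.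
  rewrite -ge0_integralZl_EFin ?powR_ge0 //.
  - apply: eq_integral => t _; rewrite -EFinM -powRM ?modulus_ge0 //.
    by rewrite -modulusM.
  - by move=> t _; rewrite lee_fin powR_ge0.
  - apply/measurable_EFinP; apply: (@measurable_funS _ _ _ _ setT) => //.
    exact: circle_measurable.
rewrite EFinM lee_wpmul2l ?lee_fin ?powR_ge0 //; apply: le_trans fM.
by apply: ereal_sup_ubound; exists r; rewrite //= in_itv.
Qed.

Lemma harmonic_powR_small s (M e : R) : 0 < s -> 0 <= M -> 0 < e ->
  exists N, forall n, (N <= n)%N -> n.+1%:R^-1 `^ s * M < e.
Proof.
(* From n + 1 >= x it follows that (n + 1)^s >= M / e + 1 > M / e. *)
move=> s0 M0 e0; pose x := (M / e + 1) `^ s^-1.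
have x0 : 0 <= x by exact: powR_ge0.
exists (Num.bound x) => n Nn.
have Me : 0 < M / e + 1 by rewrite ltr_wpDl // divr_ge0 // ltW.
have xn : x <= n.+1%:R.
  rewrite (le_trans (ltW (archi_boundP x0))) // ler_nat.
  exact: leq_trans Nn _.
have : x `^ s <= n.+1%:R `^ s by apply: ge0_ler_powR; rewrite ?nnegrE // ltW.
rewrite /x -powRrM mulVf ?gt_eqF // powRr1 ?(ltW Me) // => h.
have p0 : 0 < n.+1%:R `^ s :> R by rewrite powR_gt0.
have -> : n.+1%:R^-1 `^ s = (n.+1%:R `^ s)^-1 :> R.
  by rewrite -powR_inv1 // -powRrM mulN1r powRN.
rewrite mulrC ltr_pdivrMr //; apply: lt_le_trans (_ : e * (M / e + 1) <= _).
  by rewrite mulrDr mulr1 mulrCA divff ?gt_eqF // mulr1 ltrDl.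
by rewrite ler_wpM2l // ltW.
Qed.

(** A basic neighbourhood in the intersection constrains only finitely many exponents, so a single n
    serves all of them. *)
Lemma seq_eventually (T : eqType) (P : T -> nat -> Prop) (l : seq T) :
  (forall x, x \in l -> exists N, forall n, (N <= n)%N -> P x n) ->
  exists n, forall x, x \in l -> P x n.
Proof.
move=> lP; suff [N HN] : exists N, forall n, (N <= n)%N -> forall x, x \in l -> P x n.
  by exists N; exact: HN.
elim: l lP => [|y l IH] lP; first by exists 0%N.
have [N1 H1] := IH (fun x xl => lP x (mem_behead (s := y :: l) xl)).
have [N2 H2] := lP y (mem_head _ _).
exists (maxn N1 N2) => n; rewrite geq_max => /andP[n1 n2] x.
by rewrite inE => /orP[/eqP ->|xl]; [exact: H2|exact: H1].
Qed.

Lemma dense_subspace_of_kernel S q H s0 a b : a < b -> (0 < q)%E -> S s0 ->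
  (forall s, S s -> 0 < s) -> singular_kernel S q H ->
  contains_dense_subspace S
    (((\bigcap_(s in S) hardy s) `\` local_hardy q a b) `|` [set 0]).
Proof.
move=> ab q0 Ss0 S0 kH.
pose X : set U := \bigcap_(s in S) hardy s.
pose Y : set U := local_hardy q a b.
have sX : subspace X by exact: bigcap_hardy_subspace.
have sY : subspace Y by exact: local_hardy_subspace.
pose I : choiceType := {classic {p : U * nat | (X `&` Y) p.1}}.
pose y (i : I) : U := (sval i).1.
pose k (i : I) : R := (sval i).2.+1%:R^-1.
have yX i : X (y i) by exact: (svalP i).1.
have yY i : Y (y i) by exact: (svalP i).2.
(* The angles fill part of the middle half of [a, a + L]: [L <= b - a] keeps them strictly inside
   ]a, b[, and [L <= 1] keeps the differences of angles below pi, as [dist1_ge] requires. *)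
pose L := Num.min (b - a) 1.
have L0 : 0 < L by rewrite lt_min subr_gt0 ab ltr01.
have L1 : L <= 1 by rewrite ge_min lexx orbT.
have Lab : L <= b - a by rewrite ge_min lexx.
pose theta (i : I) : R := a + L / 4 + L * ternary (code (y i) (sval i).2).
have theta_itv i : a + L / 4 <= theta i <= a + L * (3 / 4).
  have /andP[t0 t1] := ternary_itv (R := R) (code (y i) (sval i).2).
  have : 0 <= L * ternary (code (y i) (sval i).2) <= L * (1 / 2).
    by rewrite mulr_ge0 ?(ltW L0) // ler_wpM2l // ltW.
  by rewrite /theta => /andP[? ?]; apply/andP; split; lra.
have theta_inj i j : theta i = theta j -> i = j.
  move=> /addrI/(mulfI (lt0r_neq0 L0))/ternary_inj/code_inj.
  move=> /(_ (yY i).1 (yY j).1); rewrite /y.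
  case: i j => [[f m] fi] [[g n] gj] /= [fg mn].
  by subst g n; congr (exist _ _ _); exact: Prop_irrelevance.
pose h (i : I) : U := rotated H (theta i).
pose v (i : I) : U := y i + (k i)%:C *: h i.
pose Z (i : I) : set U := local_hardy_germ q (theta i).
have sZ i : subspace (Z i) by exact: local_hardy_germ_subspace.
have YZ i : Y `<=` Z i.
  have /andP[t1 t2] := theta_itv i.
  move=> f Yf; exists (b - theta i); first by lra.
  by apply: local_hardy_subset Yf; [lra|rewrite subrKC].
have hX i : X (h i) by move=> s Ss; exact: rotated_hardy kH Ss.
have Xv i : X (v i) by exact: (subspaceD sX (yX i) (subspaceZ _ sX (hX i))).
have Zh i j : i != j -> Z i (h j).
  (* On [theta i, theta i + d] the distance to [theta j] stays between d and 3 d, and 3 d <= 3/2 <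
     pi. *)
  move=> ij; pose d := `|theta i - theta j| / 2.
  have d0 : 0 < d.
    rewrite divr_gt0 // normr_gt0 subr_eq0; apply: contra ij => /eqP.
    by move=> /theta_inj ->.
  exists d => //.
  apply: (rotated_local_away kH Ss0 (S0 _ Ss0) q0 d0); first by rewrite lerDl ltW.
  move=> t /andP[t1 t2]; have p2 := @pi_ge2 R.
  have /andP[i1 i2] := theta_itv i; have /andP[j1 j2] := theta_itv j.
  have dd : `|theta i - theta j| = d + d by rewrite /d; lra.
  have d1 : d + d <= 1 by rewrite -dd ler_norml; apply/andP; split; lra.
  have E : t - theta j = (theta i - theta j) + (t - theta i) by ring.
  have tt : `|t - theta i| <= d by rewrite ger0_norm ?subr_ge0 //; lra.
  apply/andP; split.
    have := lerB_normD (theta i - theta j) (t - theta i); rewrite -E; lra.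
  have := ler_normD (theta i - theta j) (t - theta i); rewrite -E; lra.
have Zv i j : i != j -> Z i (v j).
  move=> ij.
  exact: (subspaceD (sZ i) (YZ i _ (yY j)) (subspaceZ _ (sZ i) (Zh i j ij))).
have nZv i : ~ Z i (v i).
  (* Subtracting [y i], which lies in [Y] and hence in [Z i], leaves a nonzero multiple of [h i]. *)
  move=> Zvi; have := subspaceB (sZ i) Zvi (YZ i _ (yY i)).
  rewrite /v addrAC subrr add0r => /(subspaceZ ((k i)%:C)^-1 (sZ i)).
  rewrite scalerA mulVf ?scale1r.
    by case=> d d0; exact: rotated_not_local kH q0 d0.
  by rewrite -modulus_eq0 modulus_real normr_eq0 invr_eq0 pnatr_eq0.
have [V [sV vV VX VY XVY]] := exists_complement_through sX sY Xv sZ YZ Zv nZv.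
exists V; split.
- exact: subspace_submod sV.
- move=> f Vf; have [Yf|nYf] := pselect (Y f); first by right; exact: VY.
  by left; split=> //; exact: VX.
move=> O [f Of] oO.
have [ss [e [Sss e0 sub]]] := (oO : hardy_open O) f Of.
have [w Vw Yfw] := XVY (sval f) (svalP f).
have Xfw : X (sval f - w) by exact: (subspaceB sX (svalP f) (VX _ Vw)).
pose c n : C := (n.+1%:R^-1 : R)%:C.
(* Uniformity in u is essential: the angle is known only once n is chosen, since it encodes n. *)
have small s : s \in ss -> exists N, forall n, (N <= n)%N ->
    forall u, (radial_mean s 0 (2 * pi) (c n *: (rotated H u : U))%R < e%:E)%E.
  move=> /Sss Ss; have [M M0 HM] := rotated_mean kH Ss.
  have [N HN] := harmonic_powR_small (S0 _ Ss) M0 e0.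
  exists N => n Nn u.
  apply: le_lt_trans (radial_mean_scale _ (S0 _ Ss) (holomorphic_rotated u kH) (HM u)) _.
  by rewrite lte_fin modulus_real ger0_norm ?invr_ge0 // HN.
have [n Hn] := seq_eventually small.
pose i : I := exist _ (sval f - w, n) (conj Xfw Yfw).
have Xg : X (w + v i) by exact: (subspaceD sX (VX _ Vw) (Xv i)).
exists (exist _ (w + v i) Xg : hardy_space S); split; last first.
  exact: (subspaceD sV Vw (vV i)).
apply: sub => s sss /=.
have -> : w + v i - sval f = c n *: h i.
  by rewrite /v /y /= addrA [w + _]addrC subrK addrAC subrr add0r.
exact: Hn.
Qed.

End DenseSubspace.

(** * Choice of the kernel in each case *)

Theorem theoremB (R : realType) (a b : R) (hab : a < b) :
  (forall p q : \bar R, (0 < p)%E -> (p <= q)%E ->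
     contains_dense_subspace (exponents_below p)
       (((\bigcap_(s in exponents_below p) hardy s) `\` local_hardy q a b) `|` [set 0]))
  /\
  (forall (p : R) (q : \bar R), 0 < p -> (p%:E < q)%E ->
     contains_dense_subspace [set p]
       ((hardy p `\` local_hardy q a b) `|` [set 0])).
Proof.
split=> [p q p0 pq|p q p0 pq].
  have q0 : (0 < q)%E by exact: lt_le_trans pq.
  have pos s : exponents_below p s -> 0 < s by case.
  case: p p0 pq pos => [p| |] // p0 pq pos.
    rewrite lte_fin in p0.
    apply: (@dense_subspace_of_kernel _ _ _ _ (p / 2)) => //; last first.
      apply: (singular_power_kernel p0 pq) => s [s0]; rewrite lte_fin => ->.
      by rewrite s0.
    by split; rewrite ?lte_fin; lra.
  (* A negative power of w leaves H^s for large s, so a logarithmic singularity is used instead. *)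
  have -> : q = +oo%E by apply/eqP; rewrite -leye_eq.
  apply: (@dense_subspace_of_kernel _ _ _ _ 1) => //; last exact: singular_log_kernel.
  by split=> //; exact: ltry.
have q0 : (0 < q)%E by apply: lt_trans pq; rewrite lte_fin.
have pos s : [set p] s -> 0 < s by move=> ->.
(* With r > p, the p-th power of the kernel is of order |w|^(-p/r), whose means stay bounded, while
   r <= q keeps the kernel out of the local H^q. *)
have [r [pr rq]] : exists r : R, p < r /\ (r%:E <= q)%E.
  case: q pq q0 => [q| |] // pq _; first by exists q; rewrite -lte_fin.
  by exists (p + 1); rewrite ltrDl leey.
rewrite -(bigcap_set1 (@hardy R) p).
apply: (@dense_subspace_of_kernel _ _ _ _ p) => //.
by apply: (singular_power_kernel (lt_trans p0 pr) rq) => s ->; rewrite p0.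
Qed.
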